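(* Let $\lambda>-1$, and let $\beta_n(t;\lambda)$ be the recurrence coefficients of the monic orthogonal polynomials for the generalised sextic Freud weight $\omega(x;t,\lambda)=|x|^{2\lambda+1}\exp(-x^6+tx^2)$, $x\in\mathbb{R}$. Then for each fixed integer $n\ge0$, as $t\to\infty$, \begin{align*} \beta_{2n}(t;\lambda)&=\frac{n}{2t}+\frac{3\sqrt3\,n(2n-2\lambda-1)}{8\,t^{5/2}}+\mathcal{O}(t^{-4}),\\ \beta_{2n+1}(t;\lambda)&=\tfrac13\sqrt{3t}-\frac{4n-2\lambda+1}{4t}-\frac{\sqrt3\,(36n^2-72\lambda n+12\lambda^2-24\lambda+5)}{32\,t^{5/2}}+\mathcal{O}(t^{-4}), \end{align*} and as $t\to-\infty$, \begin{align*} \beta_{2n}(t;\lambda)&=-\frac{n}{t}-\frac{3n[10n^2+6(2\lambda+1)n+3\lambda^2+3\lambda+2]}{t^4}+\mathcal{O}(t^{-7}),\\ \beta_{2n+1}(t;\lambda)&=-\frac{n+\lambda+1}{t}-\frac{3(n+\lambda+1)[10n^2+(8\lambda+14)n+(\lambda+3)(\lambda+2)]}{t^4}+\mathcal{O}(t^{-7}). \end{align*}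
   Context: The weight is symmetric, so the monic orthogonal polynomials $P_n$ (with $\int_{-\infty}^\infty P_mP_n\,\omega\,dx=h_n\delta_{m,n}$, $h_n>0$) satisfy $P_{n+1}(x)=xP_n(x)-\beta_n(t;\lambda)P_{n-1}(x)$ with $P_{-1}=0$, $P_0=1$; here $\beta_n=h_n/h_{n-1}$ for $n\ge1$, and by convention $\beta_0=0$. The asymptotics are for fixed $n$ and $\lambda$. *)

(* Defs.v *)
From HB Require Import structures.
From mathcomp Require Import all_boot all_order all_algebra.
From mathcomp Require Import all_classical all_reals all_analysis.

Set Implicit Arguments.
Unset Strict Implicit.
Unset Printing Implicit Defensive.

Import Order.TTheory GRing.Theory Num.Theory.
Import numFieldNormedType.Exports.

Local Open Scope ring_scope.

(* The Landau notations only accept filters with a packed instance. *)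
Canonical pinfty_filter_on (R : numFieldType) := FilterType (pinfty_nbhs R) _.
Canonical ninfty_filter_on (R : numFieldType) := FilterType (ninfty_nbhs R) _.

(* At x = 0, where |x| `^ (2 lambda + 1) should be infinite for
   lambda < -1/2, powR takes the value 0; this does not affect integrals. *)
Definition freud_weight (R : realType) (lambda t x : R) : R :=
  `|x| `^ (2 * lambda + 1) * expR (- x ^+ 6 + t * x ^+ 2).

Definition weighted_dot (R : realType) (w : R -> R) (p q : {poly R}) : R :=
  \int[lebesgue_measure]_x (p.[x] * q.[x] * w x).

Definition monic_orthogonal (R : realType) (w : R -> R)
    (P : nat -> {poly R}) : Prop :=
  [/\ forall n, P n \is monic /\ size (P n) = n.+1,
      forall m n, m != n -> weighted_dot w (P m) (P n) = 0
    & forall n, 0 < weighted_dot w (P n) (P n)].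

(* P_{n+1} = x P_n - beta_n P_{n-1}, where P_{-1} = 0; since the recurrence
   for n = 0 does not determine beta_0, it is fixed by convention. *)
Definition recurrence_coefficients (R : realType) (P : nat -> {poly R})
    (beta : nat -> R) : Prop :=
  beta 0%N = 0 /\
  forall n, P n.+1 = 'X * P n - beta n *: (if n is k.+1 then P k else 0).

(* Main.v *)
Require Import Defs.
From HB Require Import structures.
From mathcomp Require Import all_boot all_order all_algebra.
From mathcomp Require Import all_classical all_reals all_analysis.
From mathcomp Require Import measurable_realfun ring lra zify.
Import Order.TTheory GRing.Theory Num.Theory.
Import numFieldNormedType.Exports.
Local Open Scope classical_set_scope.
Local Open Scope ring_scope.

(** The recurrence coefficients satisfy the Volterra lattice equation
    [d beta_n / dt = beta_n (beta_(n+1) - beta_(n-1))], so the expansion of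
    [beta_(n+1)] follows from those of [beta_(n-1)] and [beta_n] by one
    logarithmic derivative, without loss of precision, and only [beta_1], the
    mean [r] of [y = x^2] under the weight, needs analysis. To make expansions
    differentiable, remainders are kept in the class of functions of a large
    variable [s] that stay bounded under iteration of [s d/ds].

    For [t = 3 s^2], put [Y = (y - s)^2 (y + 2 s)], the gap between the exponent
    [y^3 - t y] and its minimum. Integration by parts along [y (y - s) d/dy]
    bounds every mean [E Y^j], whatever [lambda > -1], and [s d/ds] maps each
    [E Y^j] to a polynomial in these means; hence they all lie in the class.
    As [r = s + (lambda + 1 - 3 E Y) / (6 s^2)], substituting repeatedly in
    [3 (r'' + 3 r r' + r^3) = t r + lambda + 1] yields the expansion of [r].
    For [t = - s], the means of [(s y)^k] play the role of [E Y^j], and the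
    recurrence [(lambda + 1 + k) m_k - s m_(k+1) = 3 m_(k+3)] of the moments
    already gives the expansion of [r]. *)

Set Implicit Arguments.
Unset Strict Implicit.
Unset Printing Implicit Defensive.

(** * Pointwise rules of differentiation *)

Section PointwiseDerivatives.
Context {R : realType}.
Implicit Types (f g : R -> R) (x a b c : R).

Lemma is_derive1_cst c x : is_derive x 1 (fun _ : R => c) 0.
Proof. exact: is_derive_cst. Qed.

Lemma is_derive1_id x : is_derive x 1 (fun y : R => y) 1.
Proof. exact: is_derive_id. Qed.

Lemma is_derive1D f g x a b : is_derive x 1 f a -> is_derive x 1 g b ->
  is_derive x 1 (fun y => f y + g y) (a + b).
Proof. exact: is_deriveD. Qed.

Lemma is_derive1B f g x a b : is_derive x 1 f a -> is_derive x 1 g b ->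
  is_derive x 1 (fun y => f y - g y) (a - b).
Proof. exact: is_deriveB. Qed.

Lemma is_derive1N f x a : is_derive x 1 f a ->
  is_derive x 1 (fun y => - f y) (- a).
Proof. exact: is_deriveN. Qed.

Lemma is_derive1M f g x a b : is_derive x 1 f a -> is_derive x 1 g b ->
  is_derive x 1 (fun y => f y * g y) (a * g x + f x * b).
Proof.
by move=> df dg; apply: is_derive_eq; rewrite [RHS]addrC /GRing.scale/= (mulrC a).
Qed.

Lemma is_derive1V f x a : f x != 0 -> is_derive x 1 f a ->
  is_derive x 1 (fun y => (f y)^-1) (- a / f x ^+ 2).
Proof.
move=> fx0 df; apply: (is_derive_eq (is_deriveV fx0 df)).
by rewrite /GRing.scale/= !mulNr mulrC.
Qed.

Lemma is_derive1_div f g x a b : g x != 0 ->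
  is_derive x 1 f a -> is_derive x 1 g b ->
  is_derive x 1 (fun y => f y / g y) ((a * g x - f x * b) / g x ^+ 2).
Proof.
move=> gx0 df dg.
apply: (is_derive_eq (is_derive1M df (is_derive1V gx0 dg))); by field.
Qed.

Lemma is_derive1X f x a n : is_derive x 1 f a ->
  is_derive x 1 (fun y => f y ^+ n) (n%:R * f x ^+ n.-1 * a).
Proof.
move=> df; elim: n => [|n IH] /=.
  rewrite !mul0r (_ : (fun _ => _) = cst 1); first exact: is_derive_cst.
  by apply/funext => y; rewrite expr0.
under eq_fun do rewrite exprS.
apply: is_derive_eq (is_derive1M df IH) _.
by case: n {IH} => [|n] /=; rewrite ?exprS ?expr0 -?(natr1 n.+1); ring.
Qed.

Lemma is_derive1_sum (I : Type) (r : seq I) (P : pred I) (f : I -> R -> R)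
    (d : I -> R) x : (forall i, is_derive x 1 (f i) (d i)) ->
  is_derive x 1 (fun y => \sum_(i <- r | P i) f i y) (\sum_(i <- r | P i) d i).
Proof.
move=> df; elim: r => [|i r IH].
  under eq_fun do rewrite big_nil.
  by rewrite big_nil; exact: is_derive_cst.
under eq_fun do rewrite big_cons.
by rewrite big_cons; case: (P i) => //; exact: is_derive1D.
Qed.

Lemma near_eq_is_derive1 f g x a : (\near x, f x = g x) ->
  is_derive x 1 f a -> is_derive x 1 g a.
Proof. exact: near_eq_is_derive. Qed.

Lemma is_derive1_unique f x a b :
  is_derive x 1 f a -> is_derive x 1 f b -> a = b.
Proof. by move=> [_ <-] [_ <-]. Qed.

End PointwiseDerivatives.

(** * Moments of the weight *)

Section Moments.
Context {R : realType} (lambda : R).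
Local Notation mu := (@lebesgue_measure R).
Local Notation w := (freud_weight lambda).

Lemma freud_weight_ge0 t x : 0 <= w t x.
Proof. by rewrite mulr_ge0 ?powR_ge0 ?expR_ge0. Qed.

Lemma measurable_freud_weight t : measurable_fun setT (w t).
Proof.
apply: measurable_funM.
  apply: (measurableT_comp (@measurable_powR R (2 * lambda + 1))).
  exact: normr_measurable.
apply: measurableT_comp; first exact: measurable_expR.
apply: measurable_funD.
  by apply: measurable_funN; exact: measurable_funX.
by apply: measurable_funM => //; exact: measurable_funX.
Qed.

Lemma measurable_monomial_freud_weight (t : R) k :
  measurable_fun setT (fun x : R => x ^+ k * w t x).
Proof.
apply: measurable_funM; last exact: measurable_freud_weight.
exact: measurable_funX.
Qed.

Lemma freud_weight_shift t x :
  expR (x ^+ 2) * w t x = w (t + 1) x.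
Proof.
rewrite /freud_weight mulrCA -expRD; congr (_ * expR _); ring.
Qed.

Lemma freud_weight_monotone t t' x : t <= t' -> w t x <= w t' x.
Proof.
move=> tt'; rewrite /freud_weight ler_wpM2l ?powR_ge0// ler_expR lerD2l.
by rewrite ler_wpM2r ?sqr_ge0.
Qed.

(** For [|x| > 1] the power is at most [(x^2)^(k+1)], which up to a factorial is a Taylor term of
    [expR (x ^+ 2)]. Hence a power of [x] costs no more than a shift of [t] by 1 in the weight. *)
Lemma norm_exprn_le_expR (x : R) k : `|x| ^+ k <= k.+1`!%:R * expR (x ^+ 2).
Proof.
have e1 : 1 <= expR (x ^+ 2).
  by apply: le_trans (expR_ge1Dx _); rewrite lerDl sqr_ge0.
have [x1|x1] := leP `|x| 1.
  apply: (@le_trans _ _ 1); first by rewrite exprn_ile1.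
  by rewrite -[leLHS]mulr1 ler_pM// ler1n fact_gt0.
apply: (@le_trans _ _ (`|x| ^+ (2 * k.+1))).
  by rewrite ler_weXn2l// ?ltW//; lia.
rewrite exprM real_normK ?num_real// -ler_pdivrMl ?ltr0n ?fact_gt0// mulrC.
apply: le_trans (@expR_ge1Dxn _ _ k (sqr_ge0 x)).
by rewrite lerDr.
Qed.

Lemma norm_monomial_freud_weight t x k :
  `|x ^+ k * w t x| <= k.+1`!%:R * w (t + 1) x.
Proof.
rewrite normrM (ger0_norm (freud_weight_ge0 _ _)) -freud_weight_shift mulrA.
by rewrite ler_wpM2r ?freud_weight_ge0// normrX norm_exprn_le_expR.
Qed.

Hypothesis mass_gt0 : forall t, 0 < \int[mu]_x w t x.

(* An infinite integral has [Rintegral] equal to [0], so positivity of the mass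
   forces integrability. *)
Lemma integrable_freud_weight t : mu.-integrable setT (EFin \o w t).
Proof.
apply/integrableP; split.
  by apply/measurable_EFinP; exact: measurable_freud_weight.
under eq_integral => x _ do rewrite /= ger0_norm ?freud_weight_ge0//.
rewrite ltey; apply/eqP => winfty.
by have := mass_gt0 t; rewrite /Rintegral winfty /= ltxx.
Qed.

Lemma integrable_monomial t k :
  mu.-integrable setT (EFin \o (fun x => x ^+ k * w t x)).
Proof.
apply: (@le_integrable _ _ _ mu setT measurableT _
  (fun x => (k.+1`!%:R)%:E * (w (t + 1) x)%:E)%E).
- apply/measurable_EFinP; exact: measurable_monomial_freud_weight.
- move=> x _ /=; rewrite lee_fin.
  apply: (le_trans (norm_monomial_freud_weight _ _ _)); exact: ler_norm.
- by apply: integrableZl => //; exact: integrable_freud_weight.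
Qed.

Definition moment t k : R := \int[mu]_x (x ^+ k * w t x).

Lemma is_derive_freud_weight (t x : R) k :
  is_derive t 1 (fun u => x ^+ k * w u x) (x ^+ k.+2 * w t x).
Proof.
rewrite /freud_weight.
have dE : is_derive t 1 (fun u => - x ^+ 6 + u * x ^+ 2)
    (0 + (1 * x ^+ 2 + t * 0)).
  exact: is_derive1D (is_derive1_cst _ _)
    (is_derive1M (is_derive1_id _) (is_derive1_cst _ _)).
have := is_derive1M (is_derive1_cst (x ^+ k) t)
  (is_derive1M (is_derive1_cst (`|x| `^ (2 * lambda + 1)) t)
    (is_derive1_comp (is_derive_expR _) dE)).
by move=> dw; apply: (is_derive_eq dw); rewrite !exprS expr0; ring.
Qed.

(** Differentiation under the integral: for [u] within 1 of [t], the derivative of the integrand is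
    dominated by a multiple of the weight at [t + 2]. *)
Lemma is_derive_moment (t : R) k : is_derive t 1 (moment ^~ k) (moment t k.+2).
Proof.
have Ia : `]t - 1, t + 1[%classic t.
  by rewrite /= in_itv /= gtrBl ltrDl ltr01.
have derW u x : derivable (fun u => x ^+ k * w u x) u 1.
  by have [] := is_derive_freud_weight u x k.
have dW u x : partial1of2 (fun u x => x ^+ k * w u x) u x = x ^+ k.+2 * w u x.
  by rewrite partial1of2E; have [_ ->] := is_derive_freud_weight u x k.
have G0 x : 0 <= k.+3`!%:R * w (t + 1 + 1) x.
  by rewrite mulr_ge0// freud_weight_ge0.
have iG : mu.-integrable setT
    (EFin \o (fun x => k.+3`!%:R * w (t + 1 + 1) x)).
  rewrite /comp; under eq_fun do rewrite EFinM.
  by apply: integrableZl => //; exact: integrable_freud_weight.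
have ub u x : `]t - 1, t + 1[%classic u -> setT x ->
    `|partial1of2 (fun u x => x ^+ k * w u x) u x|
      <= k.+3`!%:R * w (t + 1 + 1) x.
  rewrite /= in_itv /= => /andP[_ /ltW ut] _; rewrite dW.
  apply: le_trans (norm_monomial_freud_weight _ _ _) _.
  by rewrite ler_wpM2l// freud_weight_monotone// lerD2r.
apply: DeriveDef.
  exact: (derivable_under_integral measurableT Ia
    (fun u _ => integrable_monomial u k) (fun u x _ _ => derW u x) G0 iG ub).
rewrite -derive1E (differentiation_under_integral measurableT Ia
    (fun u _ => integrable_monomial u k) (fun u x _ _ => derW u x) G0 iG ub).
by apply: eq_Rintegral => x _; rewrite dW.
Qed.

(** * Integration by parts on both sides of the possible singularity at 0 *)

Section IntegrationByParts.
Variables (t : R) (j : nat).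

(** [g] is the derivative of [G] away from 0; that [g] has integral 0 is the moment recurrence. *)
Let G (x : R) := x ^+ j.+1 * w t x.
Let g (x : R) := (j%:R + 2 * lambda + 2) * (x ^+ j * w t x)
  + 2 * t * (x ^+ j.+2 * w t x) - 6 * (x ^+ j.+4.+2 * w t x).

(** With base [x ^+ 2], positive on both sides of 0, one chain rule differentiates the weight for
    either sign of [x]. *)
Lemma freud_weightE x :
  w t x = (x ^+ 2) `^ (lambda + 2^-1) * expR (- x ^+ 6 + t * x ^+ 2).
Proof.
rewrite /freud_weight; congr (_ * _).
rewrite -[x ^+ 2]real_normK ?num_real// -[`|x| ^+ 2]powR_mulrn// -powRrM.
by congr (_ `^ _); field.
Qed.

Lemma is_derive_freud_weight_var (x : R) : x != 0 ->
  is_derive x 1 (w t) (((2 * lambda + 1) / x + 2 * t * x - 6 * x ^+ 5) * w t x).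
Proof.
move=> x0; have x20 : 0 < x ^+ 2 by rewrite exprn_even_gt0.
rewrite (_ : w t = fun y => (y ^+ 2) `^ (lambda + 2^-1)
    * expR (- y ^+ 6 + t * y ^+ 2)); last first.
  by apply/funext => y; rewrite freud_weightE.
have dX k := is_derive1X k (is_derive1_id x).
have dp : is_derive x 1 (fun y => (y ^+ 2) `^ (lambda + 2^-1)) _ :=
  @is_derive1_comp _ (fun y : R => y `^ (lambda + 2^-1)) (fun y => y ^+ 2) _ _ _
    (is_derive1_powR (lambda + 2^-1) x20) (dX 2%N).
have de : is_derive x 1 (fun y => expR (- y ^+ 6 + t * y ^+ 2)) _ :=
  @is_derive1_comp _ expR (fun y => - y ^+ 6 + t * y ^+ 2) _ _ _
    (is_derive_expR _)
    (is_derive1D (is_derive1N (dX 6%N))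
       (is_derive1M (is_derive1_cst t x) (dX 2%N))).
apply: (is_derive_eq (is_derive1M dp de)) => /=.
(* The derivative carries the exponent lowered by one; splitting off [x ^+ 2] leaves a single real
   power, which [field] treats as an atom. *)
have -> : (x ^+ 2) `^ (lambda + 2^-1)
    = (x ^+ 2) `^ (lambda + 2^-1 - 1) * x ^+ 2.
  rewrite -[X in _ = _ * X]powRr1 ?ltW// -powRD ?subrK//.
  by rewrite (gt_eqF x20) implybT.
set p := _ `^ _; set e := expR _; rewrite !exprS !expr0.
by field.
Qed.

Lemma is_derive_monomial_freud_weight (x : R) : x != 0 -> is_derive x 1 G (g x).
Proof.
move=> x0; apply: (is_derive_eq (is_derive1M
  (is_derive1X j.+1 (is_derive1_id x)) (is_derive_freud_weight_var x0))).
by rewrite /g -natr1 /= !exprS expr0; field.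
Qed.

Lemma Rintegral_freud_segment a b : a < b -> (0 < a) || (b < 0) ->
  \int[mu]_(x in `[a, b]) g x = G b - G a.
Proof.
move=> ab ab0.
have n0 x : x \in `[a, b] -> x != 0.
  rewrite in_itv /= => /andP[ax xb]; case/orP: ab0 => [a0|b0].
    by rewrite gt_eqF// (lt_le_trans a0).
  by rewrite lt_eqF// (le_lt_trans xb).
have dG x : x \in `[a, b] -> is_derive x 1 G (g x).
  by move=> /n0; exact: is_derive_monomial_freud_weight.
have cG x : x \in `[a, b] -> {for x, continuous G}.
  move=> /dG[dGx _]; apply: differentiable_continuous.
  exact/derivable1_diffP.
have ain : a \in `[a, b] by rewrite in_itv /= lexx ltW.
have bin : b \in `[a, b] by rewrite in_itv /= lexx ltW.
have cw k : {in `[a, b],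
    forall x : R, derivable (fun y : R => y ^+ k * w t y) x 1}.
  move=> x /n0 x0; apply: derivableM.
    by have [d _] := is_derive1X k (is_derive1_id x); exact: d.
  by have [d _] := is_derive_freud_weight_var x0; exact: d.
rewrite /Rintegral (@continuous_FTC2 _ g G)//.
- apply: derivable_within_continuous => x xab; rewrite /g.
  apply: derivableB; first apply: derivableD.
  + by apply: derivableM => //; exact: cw.
  + by apply: derivableM => //; exact: cw.
  + by apply: derivableM => //; exact: cw.
- split.
  + by move=> x /subset_itv_oo_cc/dG[].
  + by apply: cvg_at_right_filter; exact: cG.
  + by apply: cvg_at_left_filter; exact: cG.
- by move=> x /subset_itv_oo_cc/dG dGx; rewrite derive1E; exact: derive_val.
Qed.

(** This makes the boundary terms at 0 vanish: the exponent [2 * lambda + 2] is positive once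
    [lambda > -1]. *)
Lemma monomial_freud_weight_small x : 0 < `|x| <= 1 ->
  `|G x| <= expR `|t| * `|x| `^ (2 * lambda + 2).
Proof.
move=> /andP[x0 x1].
have x2 : x ^+ 2 <= 1 by rewrite -real_normK ?num_real// exprn_ile1.
have e1 : expR (- x ^+ 6 + t * x ^+ 2) <= expR `|t|.
  rewrite ler_expR; apply: (@le_trans _ _ (`|t| * x ^+ 2)).
    rewrite -[leRHS]add0r lerD//; last by rewrite ler_wpM2r ?sqr_ge0// ler_norm.
    by rewrite oppr_le0 exprn_even_ge0.
  by rewrite ler_piMr.
rewrite /G normrM (ger0_norm (freud_weight_ge0 _ _)) normrX /freud_weight.
rewrite (_ : 2 * lambda + 2 = 1 + (2 * lambda + 1)); last by ring.
rewrite (@powRD _ _ 1 (2 * lambda + 1)) ?(gt_eqF x0) ?implybT// powRr1//.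
rewrite [leRHS]mulrC -mulrA.
rewrite ler_pM ?mulr_ge0 ?expR_ge0 ?powR_ge0 ?exprn_ge0//.
  by rewrite exprS ler_piMr// exprn_ile1.
by rewrite ler_wpM2l// powR_ge0.
Qed.

(** With [u = x^2], the sextic term absorbs the quadratic one. If [u <= c] then [c u <= c^2];
    otherwise [u^2 >= c] and the left side is at most 0. *)
Lemma sextic_exponent_le (c u : R) : 1 <= c -> 0 <= u ->
  c * u - u ^+ 3 <= c ^+ 2.
Proof.
move=> c1 u0; have [uc|/ltW cu] := leP u c.
  by have := exprn_ge0 3 u0; rewrite expr2; nra.
have cuu : c <= u ^+ 2 by rewrite expr2; nra.
by have := sqr_ge0 c; rewrite [u ^+ 3]exprS; nra.
Qed.

Lemma monomial_freud_weight_large : exists C, forall x, 1 <= `|x| ->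
  `|G x| <= C * `|x|^-1.
Proof.
(* [M] is an integer above [2 * lambda + 1], so that a natural power bounds the real one for
   [|x| >= 1]. [c] dominates [t + 1], the coefficient of [x^2] after the remaining power has been
   traded for [expR (x ^+ 2)]. *)
pose M := (Num.truncn `|2 * lambda + 1|).+1.
pose c := `|t| + 2.
exists ((j.+2 + M).+1`!%:R * expR (c ^+ 2)) => x x1.
have x0 : 0 < `|x| by rewrite (lt_le_trans _ x1).
rewrite ler_pdivlMr// /G normrM (ger0_norm (freud_weight_ge0 _ _)) normrX.
rewrite mulrAC -exprSr /freud_weight mulrA.
apply: (@le_trans _ _ (`|x| ^+ (j.+2 + M) * expR (- x ^+ 6 + t * x ^+ 2))).
  rewrite ler_wpM2r ?expR_ge0// exprD ler_wpM2l ?exprn_ge0// -powR_mulrn//.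
  apply: ler_powR => //; apply: le_trans (ler_norm _) _.
  by rewrite ltW// truncnS_gt.
apply: (le_trans (ler_wpM2r (expR_ge0 _) (norm_exprn_le_expR _ _))).
rewrite -mulrA -expRD ler_wpM2l// ler_expR.
have := @sextic_exponent_le c (x ^+ 2).
rewrite -exprM => /(_ _ (sqr_ge0 x)) H.
apply: le_trans (H _); last by rewrite /c; have := normr_ge0 t; lra.
rewrite /c; have := ler_norm t; have := sqr_ge0 x.
set y := x ^+ 2; set z := x ^+ 6; nra.
Qed.

(** These sets avoid 0 and exhaust the nonzero reals; the shift by 2 keeps the inverse strictly
    below [n.+2%:R] already at [n = 0]. *)
Let seg n : set R := `[n.+2%:R^-1, n.+2%:R] `|` `[- n.+2%:R, - n.+2%:R^-1].

Lemma integrable_monomial_freud_weight_derivative :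
  mu.-integrable setT (EFin \o g).
Proof.
have iZ c k : mu.-integrable setT (EFin \o (fun x => c * (x ^+ k * w t x))).
  rewrite /comp; under eq_fun do rewrite EFinM.
  by apply: integrableZl => //; exact: integrable_monomial.
rewrite /comp /g; under eq_fun do rewrite EFinB EFinD.
by apply: integrableB => //; [apply: integrableD => //|]; exact: iZ.
Qed.

Lemma Rintegral_freud_seg n : \int[mu]_(x in seg n) g x
  = (G n.+2%:R - G n.+2%:R^-1) + (G (- n.+2%:R^-1) - G (- n.+2%:R)).
Proof.
have n2 : n.+2%:R^-1 < n.+2%:R :> R.
  by rewrite (@lt_trans _ _ 1) ?invf_lt1 ?ltr1n ?ltr0n.
rewrite /seg Rintegral_setU//=.
- rewrite !Rintegral_freud_segment ?ltrN2 ?invr_gt0 ?ltr0n//.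
  by rewrite oppr_lt0 invr_gt0 ltr0n orbT.
- apply: integrableS integrable_monomial_freud_weight_derivative => //.
  exact: measurableU.
- rewrite disj_set2E; apply/eqP/seteqP; split=> // x /=.
  rewrite !in_itv /= => -[/andP[a _] /andP[_ b]].
  have := le_trans a b.
  by rewrite leNgt (@lt_trans _ _ 0)// ?oppr_lt0 ?invr_gt0 ?ltr0n.
Qed.

Hypothesis lambda_gt : -1 < lambda.

Let inv_nat_cvg : ((n.+2%:R : R)^-1) @[n --> \oo] --> 0.
Proof. by have := @cvg_harmonic R; rewrite -cvg_shiftS. Qed.

(** The sign [(-1) ^+ e] treats both ends of the line at once. *)
Let cvg_large (e : bool) : G ((-1) ^+ e * n.+2%:R) @[n --> \oo] --> 0.
Proof.
have [C GC] := monomial_freud_weight_large.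
apply: norm_cvg0; apply: (@squeeze_cvgr _ _ _ _ (cst 0) (fun n => C * n.+2%:R^-1)).
- near=> n; rewrite normr_ge0 /=.
  have := GC ((-1) ^+ e * n.+2%:R).
  by rewrite normrM normrX normrN1 expr1n mul1r ger0_norm// => ->//; rewrite ler1n.
- exact: cvg_cst.
- by rewrite -[X in _ --> X](mulr0 C); apply: cvgMr; exact: inv_nat_cvg.
Unshelve. all: by end_near. Qed.

Let cvg_small (e : bool) : G ((-1) ^+ e * n.+2%:R^-1) @[n --> \oo] --> 0.
Proof.
have l0 : 0 < 2 * lambda + 2 by move: lambda_gt; lra.
apply: norm_cvg0; apply: (@squeeze_cvgr _ _ _ _ (cst 0)
  (fun n => expR `|t| * (n.+2%:R^-1) `^ (2 * lambda + 2))).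
- near=> n; rewrite normr_ge0 /=.
  have := @monomial_freud_weight_small ((-1) ^+ e * n.+2%:R^-1).
  rewrite normrM normrX normrN1 expr1n mul1r ger0_norm ?invr_ge0// => ->//.
  by rewrite invr_gt0 ltr0n /= invf_le1 ?ltr0n ?ler1n.
- exact: cvg_cst.
- rewrite -[X in _ --> X](mulr0 (expR `|t|)); apply: cvgMr.
  have /cvg_at_rightP := powR_cvg0 l0; apply; split; last exact: inv_nat_cvg.
  by move=> n; rewrite invr_gt0 ltr0n.
Unshelve. all: by end_near. Qed.

Let cvg_Rintegral_seg : (\int[mu]_(x in seg n) g x) @[n --> \oo] --> 0.
Proof.
rewrite (_ : (fun n => _) = (fun n =>
    (G ((-1) ^+ false * n.+2%:R) - G ((-1) ^+ false * n.+2%:R^-1))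
    + (G ((-1) ^+ true * n.+2%:R^-1) - G ((-1) ^+ true * n.+2%:R)))); last first.
  by apply/funext => n; rewrite Rintegral_freud_seg expr0 expr1 !mul1r !mulN1r.
rewrite [X in _ --> X](_ : 0 = (0 - 0) + (0 - 0)); last by rewrite !subr0 addr0.
exact: cvgD (cvgB (cvg_large false) (cvg_small false))
  (cvgB (cvg_small true) (cvg_large true)).
Qed.

(** The integrals over [seg n] are differences of boundary values of [G], which tend to 0; by
    dominated convergence they also tend to the full integral. *)
Lemma Rintegral_monomial_freud_weight_derivative : \int[mu]_x g x = 0.
Proof.
have ig := integrable_monomial_freud_weight_derivative.
have mseg n : measurable (seg n) by exact: measurableU.
have gE x : x != 0 -> (g \_ (seg n)) x @[n --> \oo] --> g x.
  move=> x0; apply: cvg_near_cst; near=> n.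
  have le2 : n%:R <= n.+2%:R :> R by rewrite ler_nat ltnW.
  have n1 : n.+2%:R^-1 <= `|x|.
    rewrite invf_ple ?posrE ?normr_gt0 ?ltr0n// (le_trans _ le2)//.
    by near: n; exact: nbhs_infty_ger.
  have n2 : `|x| <= n.+2%:R.
    by rewrite (le_trans _ le2)//; near: n; exact: nbhs_infty_ger.
  rewrite patchE ifT// inE /seg /= !in_itv /=.
  have [x_ge0|x_lt0] := leP 0 x.
    by left; rewrite -(ger0_norm x_ge0) n1.
  by right; rewrite lerNl lerNr -(ltr0_norm x_lt0) n1 n2.
have mg : measurable_fun setT (EFin \o g) by exact: measurable_int ig.
have [|||||_ _ Icvg] := @dominated_convergence _ _ _ mu setT measurableT
  (fun n => EFin \o (g \_ (seg n))) (EFin \o g) (abse \o (EFin \o g)) => //.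
- move=> n; rewrite -restrict_EFin; apply/(measurable_restrictT _ (mseg n)).
  exact: measurable_funTS.
(* Pointwise convergence is established off the null set [[set 0]]. *)
- exists [set 0]; split => //; first exact: lebesgue_measure_set1.
  move=> x /=; apply: contra_notP => /eqP x0 _.
  by apply: cvg_EFin; [exact: nearW|exact: gE].
- exact: integrable_abse.
- apply: aeW => x n _ /=; rewrite lee_fin patchE.
  by case: ifPn => _; rewrite ?normr0.
have {}Icvg : (\int[mu]_x (g \_ (seg n)) x) @[n --> \oo] --> \int[mu]_x g x.
  apply: fine_cvg; rewrite fineK//.
  exact: integrable_fin_num.
apply: (cvg_unique _ Icvg) => //=.
rewrite [X in X @ _](_ : _ = fun n => \int[mu]_(x in seg n) g x).
  exact: cvg_Rintegral_seg.
by apply/funext => n; rewrite Rintegral_mkcond.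
Unshelve. all: by end_near. Qed.

Lemma moment_recurrence :
  (j%:R + 2 * lambda + 2) * moment t j + 2 * t * moment t j.+2
    = 6 * moment t j.+2.+4.
Proof.
have iZ c k : mu.-integrable setT (EFin \o (fun x => c * (x ^+ k * w t x))).
  rewrite /comp; under eq_fun do rewrite EFinM.
  by apply: integrableZl => //; exact: integrable_monomial.
apply/eqP; rewrite -subr_eq0 -Rintegral_monomial_freud_weight_derivative.
rewrite /g RintegralB//; last first.
  rewrite /comp; under eq_fun do rewrite EFinD.
  by apply: integrableD => //; exact: iZ.
by rewrite RintegralD// !RintegralZl//; exact: integrable_monomial.
Qed.

End IntegrationByParts.
End Moments.

(** * Orthogonal polynomials and the Volterra equation *)

Section MomentFunctional.
Context {R : realType}.
Implicit Types (m : nat -> R) (p q : {poly R}).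

(** The moment functional. With the sequence as a parameter, multiplication by ['X] becomes a shift
    of the moments. *)
Definition functional m p : R := \sum_(i < size p) p`_i * m i.

Lemma functional_wide N m p : (size p <= N)%N ->
  functional m p = \sum_(i < N) p`_i * m i.
Proof.
move=> pN; rewrite /functional (big_ord_widen N (fun i => p`_i * m i) pN).
rewrite big_mkcond /=; apply: eq_bigr => i _; case: ltnP => // /leq_sizeP ->//.
by rewrite mul0r.
Qed.

Lemma functionalD m p q : functional m (p + q) = functional m p + functional m q.
Proof.
pose N := maxn (size p) (size q).
rewrite !(@functional_wide N) ?leq_maxl ?leq_maxr ?size_polyD// -big_split /=.
by apply: eq_bigr => i _; rewrite coefD mulrDl.
Qed.

Lemma functionalZ m c p : functional m (c *: p) = c * functional m p.
Proof.
rewrite !(@functional_wide (size p)) ?size_scale_leq// mulr_sumr.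
by apply: eq_bigr => i _; rewrite coefZ mulrA.
Qed.

Lemma functionalN m p : functional m (- p) = - functional m p.
Proof. by rewrite -scaleN1r functionalZ mulN1r. Qed.

Lemma functionalB m p q : functional m (p - q) = functional m p - functional m q.
Proof. by rewrite functionalD functionalN. Qed.

Lemma functional1 m : functional m 1 = m 0%N.
Proof. by rewrite /functional size_poly1 big_ord1 coef1 mul1r. Qed.

Lemma functionalC m c : functional m c%:P = c * m 0%N.
Proof. by rewrite -[c%:P]mulr1 mul_polyC functionalZ functional1. Qed.

Lemma functional0 m : functional m 0 = 0.
Proof. by rewrite -[0](scale0r (1 : {poly R})) functionalZ mul0r. Qed.

Lemma functionalXM m p :
  functional m ('X * p) = functional (fun i => m i.+1) p.
Proof.
have sX : (size ('X * p)%R <= (size p).+1)%N.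
  by rewrite (leq_trans (size_polyMleq _ _))// size_polyX.
rewrite (functional_wide m sX) big_ord_recl coefXM mul0r add0r.
by apply: eq_bigr => i _; rewrite coefXM.
Qed.

(** Differentiation in the parameter, coefficient by coefficient, as opposed to the formal
    derivative in ['X]. *)
Definition pderive (t : R) (p : R -> {poly R}) (q : {poly R}) : Prop :=
  forall i, is_derive t 1 (fun s => (p s)`_i) q`_i.

Lemma pderive_cst t p : pderive t (fun _ => p) 0.
Proof. by move=> i; rewrite coef0; exact: is_derive1_cst. Qed.

Lemma pderiveC (t : R) (f : R -> R) a : is_derive t 1 f a ->
  pderive t (fun s => (f s)%:P) a%:P.
Proof.
move=> fa i; rewrite coefC; under eq_fun do rewrite coefC.
by case: (i == 0%N) => //; exact: is_derive1_cst.
Qed.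

Lemma pderiveD (t : R) (p q : R -> {poly R}) dp dq :
  pderive t p dp -> pderive t q dq ->
  pderive t (fun s => p s + q s) (dp + dq).
Proof.
move=> pd qd i; rewrite coefD; under eq_fun do rewrite coefD.
exact: is_derive1D (pd i) (qd i).
Qed.

Lemma pderiveB (t : R) (p q : R -> {poly R}) dp dq :
  pderive t p dp -> pderive t q dq ->
  pderive t (fun s => p s - q s) (dp - dq).
Proof.
move=> pd qd i; rewrite coefB; under eq_fun do rewrite coefB.
exact: is_derive1B (pd i) (qd i).
Qed.

Lemma pderiveM (t : R) (p q : R -> {poly R}) dp dq :
  pderive t p dp -> pderive t q dq ->
  pderive t (fun s => p s * q s) (dp * q t + p t * dq).
Proof.
move=> pd qd i; rewrite coefD !coefM -big_split /=; under eq_fun do rewrite coefM.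
by apply: is_derive1_sum => j; exact: is_derive1M (pd j) (qd (i - j)%N).
Qed.

Lemma pderiveX (t : R) (p : R -> {poly R}) dp j : pderive t p dp ->
  pderive t (fun s => p s ^+ j) (j%:R *: (p t ^+ j.-1 * dp)).
Proof.
move=> pd; elim: j => [|j IH].
  rewrite scale0r; under [X in pderive _ X]eq_fun do rewrite expr0.
  exact: pderive_cst.
under [X in pderive _ X]eq_fun do rewrite exprS.
rewrite (_ : _ *: _ = dp * p t ^+ j + p t * (j%:R *: (p t ^+ j.-1 * dp))).
  exact: pderiveM.
case: j {IH} => [|j]; first by rewrite /= !scale0r !mulr0 scale1r expr0 mulrC addr0.
rewrite /= -natr1 scalerDl scale1r addrC [p t ^+ j.+1 * dp]mulrC; congr (_ + _).
by rewrite [dp * _]mulrC -scalerAr mulrA -exprS.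
Qed.

(** The common size bound [N] turns the functional into a sum of fixed length, to which the product
    rule applies termwise. *)
Lemma is_derive_functional (m : R -> nat -> R) (dm : nat -> R)
    (p : R -> {poly R}) (q : {poly R}) (t : R) N :
  (forall s, (size (p s) <= N)%N) -> (size q <= N)%N ->
  (forall i, is_derive t 1 (m ^~ i) (dm i)) -> pderive t p q ->
  is_derive t 1 (fun s => functional (m s) (p s))
    (functional (m t) q + functional dm (p t)).
Proof.
move=> pN qN md pd; rewrite !(@functional_wide N)// -big_split /=.
rewrite (_ : (fun s => _) = (fun s => \sum_(i < N) (p s)`_i * m s i)).
  by apply: is_derive1_sum => i; exact: is_derive1M (pd i) (md i).
by apply/funext => s; rewrite (functional_wide _ (pN s)).
Qed.

End MomentFunctional.

Section OrthogonalPolynomials.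
Context {R : realType} (m : R -> nat -> R) (P : R -> nat -> {poly R}).
Variable beta : R -> nat -> R.
Hypothesis m_derive : forall (t : R) k, is_derive t 1 (m ^~ k) (m t k.+2).
Hypothesis P_monic : forall t n, P t n \is monic.
Hypothesis P_size : forall t n, size (P t n) = n.+1.
Hypothesis P_orth :
  forall t i j, i != j -> functional (m t) (P t i * P t j) = 0.
Hypothesis P_pos : forall t n, 0 < functional (m t) (P t n * P t n).
Hypothesis beta_rec : forall t, recurrence_coefficients (P t) (beta t).

(** Induction on the size of [q]: subtracting [lead_coef q *: P t d] lowers the size, and the
    subtracted part is orthogonal to [P t n]. *)
Lemma orthogonal_lower t n (q : {poly R}) : (size q <= n)%N ->
  functional (m t) (P t n * q) = 0.
Proof.
move=> sq; have [k] := ubnP (size q); elim: k => // k IH in q sq *.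
rewrite ltnS => sqk.
have [->|q0] := eqVneq q 0; first by rewrite mulr0 functional0.
set d := (size q).-1.
have dE : size q = d.+1 by rewrite prednK// lt0n size_poly_eq0.
pose r := q - lead_coef q *: P t d.
have sr : (size r < size q)%N.
  have lP : lead_coef (lead_coef q *: P t d) = lead_coef q.
    by rewrite lead_coefZ (eqP (P_monic t d)) mulr1.
  have sP : size (lead_coef q *: P t d) = size q.
    by rewrite size_scale ?lead_coef_eq0// P_size.
  rewrite dE ltnS; apply/leq_sizeP => i; rewrite leq_eqVlt => /predU1P[<-|di].
    rewrite coefB coefZ -[X in _ - _ * X](_ : lead_coef (P t d) = _).
      by rewrite (eqP (P_monic t d)) mulr1 /lead_coef -/d subrr.
    by rewrite /lead_coef P_size.
  rewrite coefB coefZ !nth_default ?mulr0 ?subr0 ?P_size// dE//.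
have -> : q = r + lead_coef q *: P t d by rewrite subrK.
rewrite mulrDr functionalD IH ?(leq_trans (ltnW sr))//; last first.
  by rewrite (leq_trans sr).
rewrite -scalerAr functionalZ P_orth ?mulr0 ?addr0//.
by rewrite gtn_eqF// -ltnS -dE ltnS.
Qed.

Definition sqnorm t n := functional (m t) (P t n * P t n).

Lemma P_0 t : P t 0 = 1.
Proof.
have /size_poly1P[c c0 E] : size (P t 0) == 1%N by rewrite P_size.
by have := P_monic t 0; rewrite E monicE lead_coefC => /eqP ->.
Qed.

Lemma P_recS t n : 'X * P t n.+1 = P t n.+2 + beta t n.+1 *: P t n.
Proof. by have [_ /(_ n.+1) ->] := beta_rec t; rewrite subrK. Qed.

Lemma P_rec0 t : P t 1 = 'X * P t 0.
Proof. by have [b0 /(_ 0%N) ->] := beta_rec t; rewrite b0 scale0r subr0. Qed.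

(** Both sides are the functional of [X P_(n+1) P_n]: the recurrence is applied once to [X P_n] and
    once to [X P_(n+1)]. *)
Lemma sqnorm_beta t n : sqnorm t n.+1 = beta t n.+1 * sqnorm t n.
Proof.
have : functional (m t) (P t n.+1 * ('X * P t n)) = sqnorm t n.+1.
  case: n => [|n]; first by rewrite -P_rec0.
  by rewrite P_recS mulrDr functionalD -scalerAr functionalZ
    (P_orth t (i := n.+2) (j := n)) ?mulr0 ?addr0// gtn_eqF// leqW.
rewrite mulrCA mulrA P_recS mulrDl functionalD -scalerAl functionalZ.
by rewrite (P_orth t (i := n.+2) (j := n)) ?add0r// gtn_eqF// leqW.
Qed.

Lemma beta_gt0 t n : 0 < beta t n.+1.
Proof.
rewrite -(pmulr_lgt0 _ (P_pos t n)) -/(sqnorm t n) -sqnorm_beta; exact: P_pos.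
Qed.

(** This is the square norm of [X P_n = P_(n+1) + beta_n P_(n-1)], computed by orthogonality. *)
Lemma functional_XXPP t n : functional (fun k => m t k.+2) (P t n * P t n)
  = (beta t n.+1 + beta t n) * sqnorm t n.
Proof.
rewrite -!(functionalXM (fun k => m t k.+1)) -(functionalXM (m t)).
rewrite (_ : 'X * _ = ('X * P t n) * ('X * P t n)); last by ring.
case: n => [|n].
  rewrite -P_rec0; have [-> _] := beta_rec t.
  by rewrite addr0 -sqnorm_beta.
rewrite P_recS mulrDl !mulrDr !functionalD -!scalerAl -!scalerAr !functionalZ.
have nn2 : n.+2 != n by rewrite gtn_eqF// leqW.
rewrite (P_orth t nn2) (P_orth t (i := n) (j := n.+2)) 1?eq_sym//.
rewrite -!/(sqnorm _ _) !sqnorm_beta; ring.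
Qed.

(** The bound [size q <= n] records that the leading coefficient is constant; it makes the
    derivative orthogonal to [P t n]. *)
Let derivable_P (t : R) n := exists2 q : {poly R},
  (size q <= n)%N & pderive t (P ^~ n) q.

(** The variation of [P t n] contributes nothing, by orthogonality; only that of the moments
    remains, and it inserts [X^2] into the functional. *)
Let is_derive_sqnorm_aux (t : R) n : derivable_P t n ->
  is_derive t 1 (sqnorm ^~ n) ((beta t n.+1 + beta t n) * sqnorm t n).
Proof.
move=> [q sq dq]; have pPP := pderiveM dq dq.
have sPP s : (size (P s n * P s n)%R <= n.*2.+1)%N.
  by rewrite (leq_trans (size_polyMleq _ _))// !P_size addSn addnS addnn.
have E : q * P t n + P t n * q = 2%:R *: (P t n * q).
  by rewrite [q * _]mulrC scaler_nat mulr2n.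
have sdPP : (size (q * P t n + P t n * q)%R <= n.*2.+1)%N.
  rewrite E (leq_trans (size_scale_leq _ _))// (leq_trans (size_polyMleq _ _))//.
  by rewrite P_size; lia.
apply: (is_derive_eq (is_derive_functional sPP sdPP (m_derive t) pPP)).
by rewrite functional_XXPP E functionalZ orthogonal_lower// mulr0 add0r.
Qed.

Let is_derive_beta_aux (t : R) n : derivable_P t n -> derivable_P t n.+1 ->
  is_derive t 1 (beta ^~ n.+1) (beta t n.+1 * (beta t n.+2 - beta t n)).
Proof.
move=> dPn dPn1.
have bE : beta ^~ n.+1 = fun s => sqnorm s n.+1 / sqnorm s n.
  by apply/funext => s; rewrite sqnorm_beta mulfK// gt_eqF//; exact: P_pos.
have S0 : sqnorm t n != 0 by rewrite gt_eqF//; exact: P_pos.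
rewrite bE; apply: (is_derive_eq (is_derive1_div S0
  (is_derive_sqnorm_aux dPn1) (is_derive_sqnorm_aux dPn))).
by rewrite sqnorm_beta; field.
Qed.

(** Two consecutive polynomials are carried through the induction: their norms give the derivative
    of [beta t n.+1], and the recurrence then differentiates the next polynomial. *)
Lemma P_derivable t n : derivable_P t n.
Proof.
suff [] : derivable_P t n /\ derivable_P t n.+1 by [].
elim: n => [|n [dPn dPn1]].
  split.
    exists 0; first by rewrite size_poly0.
    by under [X in pderive _ X]eq_fun do rewrite P_0; exact: pderive_cst.
  exists 0; first by rewrite size_poly0.
  by under [X in pderive _ X]eq_fun do rewrite P_rec0 P_0; exact: pderive_cst.
split=> //; have := is_derive_beta_aux dPn dPn1.
move: dPn dPn1 => [q sq dq] [r sr dr] db.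
exists ('X * r - ((beta t n.+1 * (beta t n.+2 - beta t n)) *: P t n
    + beta t n.+1 *: q)).
  rewrite (leq_trans (size_polyD _ _))// geq_max size_polyN; apply/andP; split.
    by rewrite (leq_trans (size_polyMleq _ _))// size_polyX.
  rewrite (leq_trans (size_polyD _ _))// geq_max; apply/andP; split.
    by rewrite (leq_trans (size_scale_leq _ _))// P_size leqW.
  by rewrite (leq_trans (size_scale_leq _ _))// (leq_trans sq) ?leqW.
rewrite (_ : P ^~ n.+2 = fun s => 'X * P s n.+1 - (beta s n.+1)%:P * P s n).
  have := pderiveB (pderiveM (pderive_cst t 'X) dr) (pderiveM (pderiveC db) dq).
  by rewrite mul0r add0r !mul_polyC.
by apply/funext => s; rewrite P_recS mul_polyC addrK.
Qed.

Lemma is_derive_beta (t : R) n : is_derive t 1 (beta ^~ n.+1)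
  (beta t n.+1 * (beta t n.+2 - beta t n)).
Proof. exact: is_derive_beta_aux (P_derivable t n) (P_derivable t n.+1). Qed.

Lemma beta_1E t : beta t 1 = m t 2 / m t 0.
Proof.
have := sqnorm_beta t 0; rewrite /sqnorm P_rec0 P_0 !mulr1 functional1.
rewrite functionalXM -[X in functional _ X]mulr1 functionalXM functional1 => ->.
rewrite mulfK//; have := P_pos t 0; rewrite P_0 mulr1 functional1.
by move=> m0; rewrite gt_eqF.
Qed.

End OrthogonalPolynomials.

(** * Functions bounded under iterated Euler derivatives *)

Section Symbols.
Context {R : realType}.
Implicit Types (f g h : R -> R) (N : nat).

(* [g] is the Euler derivative [s f'(s)] of [f]. *)
Fixpoint symbol N f : Prop :=
  (exists C, \forall s \near +oo, `|f s| <= C) /\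
  if N is N'.+1 then
    exists g, (\forall s \near +oo, is_derive (s : R) 1 f (g s / s)) /\ symbol N' g
  else True.

Lemma symbol_bounded N f : symbol N f ->
  exists C, \forall s \near +oo, `|f s| <= C.
Proof. by case: N => [|N] []. Qed.

Lemma symbol_euler N f : symbol N.+1 f -> exists g,
  (\forall s \near +oo, is_derive (s : R) 1 f (g s / s)) /\ symbol N g.
Proof. by case. Qed.

Lemma symbolW N f : symbol N.+1 f -> symbol N f.
Proof.
elim: N f => [|N IH] f [Cf [g [fg sg]]]; split=> //.
by exists g; split=> //; exact: IH.
Qed.

(** An identity valid for all large [s] holds around each large [s], as needed to differentiate
    it. *)
Lemma near_pinfty_nbhs (Q : set R) :
  (\forall s \near +oo, Q s) -> \forall s \near +oo, \near s, Q s.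
Proof.
move=> [M [Mr MQ]]; exists M; split=> // s Ms.
by near=> u; apply: MQ; near: u; exact: lt_nbhsr.
Unshelve. all: by end_near. Qed.

Lemma eq_symbol N f g : (\forall s \near +oo, f s = g s) ->
  symbol N f -> symbol N g.
Proof.
move=> fg; case: N => [|N] [[C fC] sf]; split=> //.
- by exists C; near=> s; have <- : f s = g s; near: s.
- by exists C; near=> s; have <- : f s = g s; near: s.
- case: sf => h [fh sh]; exists h; split=> //; near=> s.
  apply: (@near_eq_is_derive _ _ _ f); last by near: s.
  by near: s; exact: near_pinfty_nbhs.
Unshelve. all: by end_near. Qed.

Lemma symbol_cst N (c : R) : symbol N (fun _ => c).
Proof.
elim: N c => [|N IH] c; split=> //; try by exists `|c|; near=> s.
exists (fun _ => 0); split=> //; near=> s.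
by rewrite mul0r; exact: is_derive1_cst.
Unshelve. all: by end_near. Qed.

Lemma symbolD N f g : symbol N f -> symbol N g -> symbol N (fun s => f s + g s).
Proof.
elim: N f g => [|N IH] f g [[Cf fC] sf] [[Cg gC] sg]; split=> //.
- exists (Cf + Cg); near=> s.
  by apply: (le_trans (ler_normD _ _)); apply: lerD; near: s.
- exists (Cf + Cg); near=> s.
  by apply: (le_trans (ler_normD _ _)); apply: lerD; near: s.
- case: sf sg => [f' [ff' sf']] [g' [gg' sg']].
  exists (fun s => f' s + g' s); split; last exact: IH.
  near=> s; rewrite mulrDl; apply: is_derive1D; by near: s.
Unshelve. all: by end_near. Qed.

Lemma symbolM N f g : symbol N f -> symbol N g -> symbol N (fun s => f s * g s).
Proof.
elim: N f g => [|N IH] f g sf sg.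
  case: sf sg => [[Cf fC] _] [[Cg gC] _]; split=> //.
  exists (Cf * Cg); near=> s.
  by rewrite normrM; apply: ler_pM => //; near: s.
split.
  have [Cf fC] := symbol_bounded sf; have [Cg gC] := symbol_bounded sg.
  exists (Cf * Cg); near=> s.
  by rewrite normrM; apply: ler_pM => //; near: s.
have [f' [ff' sf']] := symbol_euler sf.
have [g' [gg' sg']] := symbol_euler sg.
exists (fun s => f' s * g s + f s * g' s); split.
  near=> s.
  have df : is_derive s 1 f (f' s / s) by near: s.
  have dg : is_derive s 1 g (g' s / s) by near: s.
  by apply: (is_derive_eq (is_derive1M df dg)); rewrite mulrDl mulrA mulrAC.
by apply: symbolD; apply: IH => //; exact: symbolW.
Unshelve. all: by end_near. Qed.

Lemma symbolN N f : symbol N f -> symbol N (fun s => - f s).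
Proof.
move=> sf; apply: eq_symbol (symbolM (symbol_cst N (-1)) sf).
by near=> s; rewrite mulN1r.
Unshelve. all: by end_near. Qed.

Lemma symbolB N f g : symbol N f -> symbol N g -> symbol N (fun s => f s - g s).
Proof. by move=> sf sg; exact: symbolD sf (symbolN sg). Qed.

Lemma symbolX N f k : symbol N f -> symbol N (fun s => f s ^+ k).
Proof.
move=> sf; elim: k => [|k IH].
  by apply: eq_symbol (symbol_cst N 1); near=> s; rewrite expr0.
by apply: eq_symbol (symbolM sf IH); near=> s; rewrite exprS.
Unshelve. all: by end_near. Qed.

Lemma symbolV N f c : 0 < c -> (\forall s \near +oo, c <= `|f s|) ->
  symbol N f -> symbol N (fun s => (f s)^-1).
Proof.
move=> c0 cf.
have bV : exists C, \forall s \near +oo, `|(f s)^-1| <= C.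
  exists c^-1; near=> s.
  have cfs : c <= `|f s| by near: s.
  by rewrite normfV lef_pV2 ?posrE// (lt_le_trans c0).
elim: N => [|N IH] sf; split=> //.
have [f' [ff' sf']] := symbol_euler sf.
exists (fun s => - (f' s) * ((f s)^-1 * (f s)^-1)); split.
  near=> s.
  have df : is_derive s 1 f (f' s / s) by near: s.
  have cfs : c <= `|f s| by near: s.
  have f0 : f s != 0 by rewrite -normr_gt0 (lt_le_trans c0).
  apply: (is_derive_eq (is_derive1V f0 df)).
  by rewrite expr2 invfM !mulNr mulrAC.
have sV := IH (symbolW sf).
by apply: symbolM (symbolN sf') (symbolM sV sV).
Unshelve. all: by end_near. Qed.

Lemma near_pinfty_neq0 : \forall s \near +oo, s != 0 :> R.
Proof.
by near=> s; rewrite gt_eqF.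
Unshelve. all: by end_near. Qed.

Lemma symbol_inv N (c : R) : symbol N (fun s => c / s).
Proof.
have b d : exists C, \forall s \near +oo, `|d / s| <= C :> R.
  exists `|d|; near=> s.
  have s1 : 1 <= s by near: s; apply: nbhs_pinfty_ge; exact: num_real.
  rewrite normrM normfV (ger0_norm (le_trans ler01 s1)).
  by rewrite ler_piMr// invf_le1// (lt_le_trans ltr01).
elim: N c => [|N IH] c; split=> //.
exists (fun s => - c / s); split=> //; near=> s.
have s0 : s != 0 by near: s; exact: near_pinfty_neq0.
apply: (is_derive_eq (is_derive1_div s0 (is_derive1_cst c s) (is_derive1_id s))).
by field.
Unshelve. all: by end_near. Qed.

(** The small parameter of all the expansions: of order [t^(-3/2)] for [t = 3 s^2], and [- t^(-3)]
    for [t = - s]. *)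
Definition cube_inv (s : R) : R := s^-1 ^+ 3.
Local Notation x := cube_inv.

Lemma symbol_cube_inv N : symbol N x.
Proof.
apply: symbolX; apply: eq_symbol (symbol_inv N 1).
by near=> s; rewrite mul1r.
Unshelve. all: by end_near. Qed.

Lemma is_derive_cube_inv (s : R) : s != 0 -> is_derive s 1 x (- 3 * x s / s).
Proof.
move=> s0; apply: (is_derive_eq (is_derive1X 3 (is_derive1V s0 (is_derive1_id s)))).
by rewrite /x /=; field.
Qed.

Lemma cube_inv_symbol_small f e : symbol 0 f -> 0 < e ->
  \forall s \near +oo, `|x s * f s| <= e.
Proof.
move=> [[C fC] _] e0; near=> s.
have s1 : 1 <= s by near: s; apply: nbhs_pinfty_ge; exact: num_real.
have s0 : 0 < s by rewrite (lt_le_trans ltr01).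
have fs : `|f s| <= C by near: s.
have Cs : C / e <= s by near: s; apply: nbhs_pinfty_ge; exact: num_real.
have x0 : 0 <= x s by rewrite exprn_ge0 ?invr_ge0 ?ltW.
have xs : x s <= s^-1.
  rewrite /x exprS ler_piMr ?invr_ge0 ?(ltW s0)//.
  by rewrite exprn_ile1 ?invr_ge0 ?(ltW s0)// invf_le1.
rewrite normrM (ger0_norm x0) (le_trans (ler_pM _ _ xs fs))//.
by rewrite mulrC ler_pdivrMr// mulrC -ler_pdivrMr.
Unshelve. all: by end_near. Qed.

End Symbols.

Ltac prove_symbol := repeat (first
  [ eassumption
  | match goal with
    | |- symbol _ (fun _ => ?c) => exact: symbol_cst
    | |- symbol _ (@cube_inv _) => exact: symbol_cube_inv
    | |- symbol _ (fun s => cube_inv s) => exact: symbol_cube_inv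
    | |- symbol _ (fun s => _ + - _) => apply: symbolB
    | |- symbol _ (fun s => _ + _) => apply: symbolD
    | |- symbol _ (fun s => - _) => apply: symbolN
    | |- symbol _ (fun s => _ * _) => apply: symbolM
    | |- symbol _ (fun s => _ ^+ _) => apply: symbolX
    end ]).

(** * Expansion of a logarithmic derivative *)

Section LogDerivative.
Context {R : realType}.
Local Notation x := (@cube_inv R).

(** Here [h] is the Euler derivative of [g]. As that of [x] is [- 3 x], the constant term drops out
    and the order of the remainder is kept; only one order of the symbol class is spent. *)
Lemma expansion_log_derivative N (c0 c1 : R) (g h G : R -> R) : c0 != 0 ->
  symbol N.+1 G -> (\forall s \near +oo, g s = c0 + c1 * x s + x s ^+ 2 * G s) ->
  (\forall s \near +oo, is_derive (s : R) 1 g (h s / s)) ->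
  exists K, symbol N K /\
    \forall s \near +oo, h s / g s = - 3 * (c1 / c0) * x s + x s ^+ 2 * K s.
Proof.
move=> c00 sG gE gh; have [G1 [GG1 sG1]] := symbol_euler sG.
have {}sG := symbolW sG; have sx := symbol_cube_inv N.
pose D s := c0 + c1 * x s + x s ^+ 2 * G s.
have D0 : \forall s \near +oo, `|c0| / 2 <= `|D s|.
  have sr : symbol 0 (fun s => c1 + x s * G s).
    apply: symbolD; first exact: symbol_cst.
    by apply: symbolM; [exact: symbol_cube_inv|case: N sG {sx gh sG1 GG1} => [|N] []].
  have c02 : 0 < `|c0| / 2 by rewrite divr_gt0// normr_gt0.
  have small := cube_inv_symbol_small sr c02.
  near=> s.
  have : `|x s * (c1 + x s * G s)| <= `|c0| / 2 by near: s.
  have -> : D s = c0 - - (x s * (c1 + x s * G s)) by rewrite /D; ring.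
  have := lerB_dist c0 (- (x s * (c1 + x s * G s))).
  by rewrite normrN; lra.
have sD : symbol N D by rewrite /D; prove_symbol.
have sV : symbol N (fun s => (D s)^-1).
  by apply: symbolV D0 sD; rewrite divr_gt0// normr_gt0.
(* The first factor is [h + 3 (c1 / c0) x D] divided by [x^2]. *)
exists (fun s => (G1 s - 6 * G s + 3 * (c1 ^+ 2 / c0) + 3 * (c1 / c0) * (x s * G s))
  * (D s)^-1); split.
  by prove_symbol.
near=> s.
have s0 : s != 0 by near: s; exact: near_pinfty_neq0.
have gs : g s = D s by near: s.
have Ds : D s != 0.
  have : `|c0| / 2 <= `|D s| by near: s.
  by rewrite -normr_gt0; apply: lt_le_trans; rewrite divr_gt0// normr_gt0.
have dg : is_derive s 1 g (h s / s) by near: s.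
have dG : is_derive s 1 G (G1 s / s) by near: s.
have dx := is_derive_cube_inv s0.
have dD : is_derive s 1 g (((0 + (0 * x s + c1 * (- 3 * x s / s))))
    + ((2 * x s ^+ 1 * (- 3 * x s / s)) * G s + x s ^+ 2 * (G1 s / s))).
  apply: (@near_eq_is_derive _ _ _ D).
    by near: s; apply: near_pinfty_nbhs; near=> s; apply/esym; near: s.
  exact: is_derive1D (is_derive1D (is_derive1_cst c0 s)
    (is_derive1M (is_derive1_cst c1 s) dx)) (is_derive1M (is_derive1X 2 dx) dG).
have hE : h s = - 3 * c1 * x s + x s ^+ 2 * (G1 s - 6 * G s).
  have := is_derive1_unique dg dD => /(congr1 (fun z => z * s)).
  by rewrite divfK// => ->; field.
rewrite gs hE; move: Ds; rewrite /D => Ds.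
by field; rewrite Ds c00.
Unshelve. all: by end_near. Qed.

End LogDerivative.

(** Reduces the derivation of one equation from another to an identity with an explicit multiplier
    [k], checked by [ring] or [field]. *)
Lemma eq_by_combination {R : comRingType} (a b c d k : R) :
  a = b -> c - d = k * (a - b) -> c = d.
Proof. by move=> ->; rewrite subrr mulr0 => /eqP; rewrite subr_eq0 => /eqP. Qed.

(** * Means under the weight *)

Section NormalizedMoments.
Context {R : realType} (lambda : R).
(* [m s k] stands for the mean of [x^(2k)] under the weight with [t = tau s],
   and [kappa] for the derivative of [tau]. *)
Variables (m : R -> nat -> R) (tau kappa : R -> R).
Hypothesis m_rec : forall s k,
  (lambda + 1 + k%:R) * m s k + tau s * m s k.+1 = 3 * m s k.+3.
Hypothesis m_derive : forall s k,
  is_derive (s : R) 1 (m ^~ k) (kappa s * (m s k.+1 - m s 1 * m s k)).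

Local Notation L s := (functional (m s)).

Lemma functional_euler (a : nat -> R) (p : {poly R}) :
  functional a ('X * p^`()) = functional (fun k => k%:R * a k) p.
Proof.
have sz : (size ('X * p^`())%R <= (size p).+1)%N.
  rewrite (leq_trans (size_polyMleq _ _))// size_polyX /= ltnS.
  have [->|p0] := eqVneq p 0; first by rewrite deriv0 size_poly0.
  exact: ltnW (lt_size_deriv p0).
rewrite (functional_wide _ sz) (functional_wide _ (leqnSn _)).
apply: eq_bigr => -[[|i] i_lt _]; rewrite coefXM [nat_of_ord _]/=.
  by rewrite !(mulr0n, mul0r, mulr0).
by rewrite coef_deriv !mulrnAl mulrnAr mul1r.
Qed.

(** The linear extension of [m_rec] from monomials, [X p'] multiplying the coefficient of [X^k] by
    [k]. In [y = x^2] it integrates the derivative of [y^(lambda+1) p exp(- y^3 + tau y)]. *)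
Lemma moment_functional_ibp s (p : {poly R}) :
  (lambda + 1) * L s p + L s ('X * p^`()) + tau s * L s ('X * p)
    = 3 * L s ('X * ('X * ('X * p))).
Proof.
rewrite functional_euler !functionalXM /functional !mulr_sumr -!big_split /=.
apply: eq_bigr => i _.
by rewrite [RHS]mulrCA -m_rec; ring.
Qed.

(** The factor of [kappa s] is the covariance of [y] and [p]: [t] enters the weight through
    [exp (t y)], and normalisation subtracts the product of the means. *)
Lemma is_derive_normalized_functional (p : R -> {poly R}) (q : {poly R}) (s : R) N :
  (forall u, (size (p u) <= N)%N) -> (size q <= N)%N -> pderive s p q ->
  is_derive s 1 (fun u => L u (p u))
    (L s q + kappa s * (L s ('X * p s) - m s 1 * L s (p s))).
Proof.
move=> sp sq pq.
apply: (is_derive_eq (is_derive_functional sp sq (m_derive s) pq)).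
rewrite functionalXM; congr (_ + _).
rewrite /functional mulr_sumr -sumrB mulr_sumr; apply: eq_bigr => i _; ring.
Qed.

End NormalizedMoments.

(** * Bounds for the means of powers of the gap *)

Section PositiveSide.
Context {R : realType} (lambda : R).
Hypothesis lambda_gt : -1 < lambda.
Variables (m : R -> nat -> R).
Hypothesis m_0 : forall s, m s 0 = 1.
Hypothesis m_pos : forall s (p : {poly R}), (forall y, 0 <= y -> 0 <= p.[y]) ->
  0 <= functional (m s) p.
Hypothesis m_rec : forall s k,
  (lambda + 1 + k%:R) * m s k + 3 * s ^+ 2 * m s k.+1 = 3 * m s k.+3.
Hypothesis m_derive : forall s k,
  is_derive (s : R) 1 (m ^~ k) (6 * s * (m s k.+1 - m s 1 * m s k)).

Local Notation L s := (functional (m s)).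

(* As a polynomial in [y], [gap s] is [y^3 - 3 s^2 y] minus its minimum over
   [y >= 0], which is attained at [y = s]. *)
Definition gap (s : R) : {poly R} := ('X - s%:P) ^+ 2 * ('X + (2 * s)%:P).
Definition gap_moment j s := L s (gap s ^+ j).
Local Notation Y := gap.
Local Notation F := gap_moment.

Let Z s : {poly R} := 'X - s%:P.
Let H j s := L s (Z s * Y s ^+ j).
Let A j s := L s ('X * Y s ^+ j).

Let YE s : Y s = 'X * ('X * 'X) - (3 * s ^+ 2) *: 'X + (2 * s ^+ 3)%:P.
Proof.
by rewrite /Y /Z -mul_polyC !(polyCM, rmorphXn) /=; ring.
Qed.

Let derivY s : (Y s)^`() = 3%:R *: (Z s * ('X + s%:P)).
Proof.
rewrite YE !(derivD, derivN, derivZ, derivM, derivX, derivC).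
rewrite -!mul_polyC !(polyCM, rmorphXn, polyC_natr) /Z /=.
ring.
Qed.

Let HE j s : H j s = A j s - s * F j s.
Proof. by rewrite /H /Z mulrBl functionalB mul_polyC functionalZ. Qed.

(** The factor [j%:R] makes the truncated predecessor harmless at [j = 0]. *)
Let YjE j s : j%:R *: Y s ^+ j.-1 * Y s = j%:R *: Y s ^+ j.
Proof. by case: j => [|j]; rewrite ?scale0r ?mul0r// -scalerAl -exprSr. Qed.

Let XdY j s : 'X * (Y s ^+ j)^`()
  = (3 * j%:R) *: Y s ^+ j + (6 * s ^+ 2 * j%:R) *: (Z s * Y s ^+ j.-1).
Proof.
have -> : (3 * j%:R) *: Y s ^+ j = 3%:R *: (j%:R *: Y s ^+ j.-1 * Y s).
  by rewrite YjE scalerA.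
rewrite deriv_exp derivY -mulr_natl YE.
rewrite -!mul_polyC !(polyCM, rmorphXn, polyC_natr) /Z /=.
ring.
Qed.

(** Integration by parts with [p = Y^j], using [X^3 = Y + 3 s^2 X - 2 s^3] and [XdY]. The left side
    is the combination of the [H] that occurs in the derivative of [F j]. *)
Let F_H j s : 6 * s ^+ 2 * (H j s - j%:R * H j.-1 s)
  = (lambda + 1 + 3 * j%:R) * F j s - 3 * F j.+1 s.
Proof.
have := moment_functional_ibp (tau := fun s => 3 * s ^+ 2) m_rec s (Y s ^+ j).
rewrite XdY functionalD !functionalZ -/(F j s) -/(H j.-1 s) -/(A j s).
have -> : 'X * ('X * ('X * Y s ^+ j)) = Y s ^+ j.+1
    + (3 * s ^+ 2) *: ('X * Y s ^+ j) - (2 * s ^+ 3) *: Y s ^+ j.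
  rewrite exprS {2}YE -!mul_polyC; ring.
rewrite functionalB functionalD !functionalZ -/(F j s) -/(F j.+1 s) -/(A j s) (HE j).
by move=> E; apply: (eq_by_combination (k := - 1) E); ring.
Qed.

Let sizeY s : (size (Y s) <= 4)%N.
Proof.
rewrite /Y /Z (leq_trans (size_polyMleq _ _))// size_XaddC.
by rewrite addn2 /= ltnS (leq_trans (size_poly_exp_leq _ _))// size_XsubC.
Qed.

Let sizeYj s j : (size (Y s ^+ j) <= (3 * j).+1)%N.
Proof.
rewrite (leq_trans (size_poly_exp_leq _ _))// ltnS leq_mul2r.
have := sizeY s; case: (size _) => [|n] /=; rewrite ?orbT// ltnS => ->.
by rewrite orbT.
Qed.

Let F_0 s : F 0 s = 1.
Proof. by rewrite /F expr0 functional1. Qed.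

Let H_0 s : H 0 s = m s 1 - s.
Proof.
rewrite /H expr0 mulr1 /Z functionalB functionalC m_0 mulr1.
by rewrite -['X]mulr1 functionalXM functional1.
Qed.

Let pderiveY (s : R) : pderive s Y ((- (6 * s)) *: Z s).
Proof.
have -> : Y = fun u => 'X * ('X * 'X) - (3 * u ^+ 2)%:P * 'X + (2 * u ^+ 3)%:P.
  by apply/funext => u; rewrite YE mul_polyC.
have d k := is_derive1X k (is_derive1_id s).
have := pderiveD (pderiveB (pderive_cst s ('X * ('X * 'X)))
   (pderiveM (pderiveC (is_derive1M (is_derive1_cst 3 s) (d 2%N))) (pderive_cst s 'X)))
  (pderiveC (is_derive1M (is_derive1_cst 2 s) (d 3%N))).
congr pderive.
rewrite /Z -mul_polyC !(polyCM, polyCD, polyCN, rmorphXn, polyC_natr) /=.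
ring.
Qed.

(** Since the [s]-derivative of [Y] is [- 6 s (X - s)], the derivative is [6 s] times
    [H_j - j H_(j-1) - H_0 F_j]. Applying [F_H] at [j] and at 0 leaves only gap moments, and
    [lambda] cancels. *)
Lemma is_derive_gap_moment j (s : R) : s != 0 -> is_derive s 1 (F j)
  (3 * (j%:R * F j s - F j.+1 s + F 1 s * F j s) / s).
Proof.
move=> s0.
have sq : (size (j%:R *: (Y s ^+ j.-1 * ((- (6 * s)) *: Z s)))%R <= (3 * j).+1)%N.
  case: j => [|j]; first by rewrite scale0r size_poly0.
  rewrite (leq_trans (size_scale_leq _ _))// (leq_trans (size_polyMleq _ _))//=.
  have : (size (- (6 * s) *: Z s) <= 2)%N.
    by rewrite (leq_trans (size_scale_leq _ _))// size_XsubC.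
  move: (sizeYj s j); move: (size _) (size _) => u v; lia.
apply: (is_derive_eq (is_derive_normalized_functional
  (kappa := fun s => 6 * s) m_derive (fun u => sizeYj u j) sq
  (pderiveX j (pderiveY s)))).
rewrite -/(A j s) -/(F j s) functionalZ -scalerAr functionalZ.
rewrite [_ * Z s]mulrC -/(H j.-1 s).
have E := F_H j s; have E0 := F_H 0 s.
rewrite mul0r subr0 F_0 !mulr1 H_0 in E0.

apply: (mulIf s0); rewrite divfK//.
rewrite (HE j) in E.
apply: (eq_by_combination (k := - F j s) E0).
by apply: (eq_by_combination (k := 1) E); ring.
Qed.

(** Up to the factor 3, the integrand is [Y^j] times the derivative of the exponent [y^3 - 3 s^2 y]
    along [y (y - s) d/dy]. *)
Let B j s := L s ('X * (Z s ^+ 2 * ('X + s%:P) * Y s ^+ j)).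

Let Y_ge0 s y : 0 <= s -> 0 <= y -> 0 <= (Y s).[y].
Proof.
move=> s0 y0; rewrite /Y hornerM horner_exp !hornerE mulr_ge0 ?sqr_ge0//.
by rewrite addr_ge0 ?mulr_ge0.
Qed.

Let F_ge0 j s : 0 <= s -> 0 <= F j s.
Proof.
by move=> s0; apply: m_pos => y y0; rewrite horner_exp exprn_ge0// Y_ge0.
Qed.

Let A_ge0 j s : 0 <= s -> 0 <= A j s.
Proof.
move=> s0; apply: m_pos => y y0.
by rewrite hornerM hornerX horner_exp mulr_ge0// exprn_ge0// Y_ge0.
Qed.

(* Integration by parts along [y (y - s) d/dy], which vanishes both at the
   boundary [0] and at the minimum [s]. *)
Let B_ibp j s : 3 * B j s
  = (lambda + 1) * (A j s - s * F j s) + A j s + 3 * j%:R * B j.-1 s.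
Proof.
have := moment_functional_ibp (tau := fun s => 3 * s ^+ 2) m_rec s (Z s * Y s ^+ j).
rewrite -/(H j s) (HE j).
have -> : 'X * (Z s * Y s ^+ j)^`() = 'X * Y s ^+ j
   + (3 * j%:R) *: ('X * (Z s ^+ 2 * ('X + s%:P) * Y s ^+ j.-1)).
  rewrite derivM deriv_exp derivY {1}/Z derivB derivX derivC subr0 mul1r.
  rewrite -mulr_natl -!mul_polyC !(polyCM, polyC_natr) /=; ring.
have E : 3 * B j s = 3 * L s ('X * ('X * ('X * (Z s * Y s ^+ j))))
    - 3 * s ^+ 2 * L s ('X * (Z s * Y s ^+ j)).
  rewrite -!functionalZ -functionalB; congr functional.
  by rewrite /Z -!mul_polyC !(polyCM, rmorphXn, polyC_natr) /=; ring.
rewrite functionalD functionalZ -/(A j s) -/(B j.-1 s) => E'.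
apply: (eq_by_combination (k := 1) E).
by apply: (eq_by_combination (k := - 1) E'); ring.
Qed.

(** On [y >= 0] one has [y + 2 s <= 2 (y + s)]. Together with the reverse comparison in [B_upper],
    this makes [B j] and [A j.+1] interchangeable up to a constant. *)
Let B_lower j s : 0 <= s -> A j.+1 s <= 2 * B j s.
Proof.
move=> s0; rewrite -subr_ge0 -functionalZ -functionalB; apply: m_pos => y y0.
rewrite !(hornerD, hornerN, hornerZ, hornerM, horner_exp, hornerX, hornerC).
have : 0 <= ((y - s) ^+ 2 * (y + 2 * s)) ^+ j.
  by rewrite exprn_ge0// mulr_ge0 ?sqr_ge0// addr_ge0 ?mulr_ge0.
rewrite [_ ^+ j.+1]exprS; set q := _ ^+ j => q0.
rewrite (_ : _ - _ = y ^+ 2 * (y - s) ^+ 2 * q); last by ring.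
exact: mulr_ge0 (mulr_ge0 (sqr_ge0 _) (sqr_ge0 _)) q0.
Qed.

Let B_upper j s : 0 <= s -> B j s <= A j.+1 s.
Proof.
move=> s0; rewrite -subr_ge0 -functionalB; apply: m_pos => y y0.
rewrite !(hornerD, hornerN, hornerZ, hornerM, horner_exp, hornerX, hornerC).
have : 0 <= ((y - s) ^+ 2 * (y + 2 * s)) ^+ j.
  by rewrite exprn_ge0// mulr_ge0 ?sqr_ge0// addr_ge0 ?mulr_ge0.
rewrite [_ ^+ j.+1]exprS; set q := _ ^+ j => q0.
rewrite (_ : _ - _ = y * s * (y - s) ^+ 2 * q); last by ring.
exact: mulr_ge0 (mulr_ge0 (mulr_ge0 y0 s0) (sqr_ge0 _)) q0.
Qed.

(** Both terms on the left are nonnegative, so a bound on [A j] yields one on [A j.+1], for the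
    induction, and one on [s * F j s], which is the goal. *)
Let A_step j s : 0 <= s ->
  3 / 2 * A j.+1 s + (lambda + 1) * (s * F j s)
    <= (lambda + 2 + 3 * j%:R) * A j s.
Proof.
move=> s0; have := B_ibp j s; have := B_lower j s0.
have jB : j%:R * B j.-1 s <= j%:R * A j s.
  by case: j => [|j]; [rewrite !mul0r|rewrite ler_wpM2l//=; exact: B_upper].
lra.
Qed.

Lemma gap_moment_bounded j : exists C, forall s, 1 <= s -> F j s <= C.
Proof.
have l1 : 0 < lambda + 1 by rewrite -ltrBlDr sub0r.
have Ab : exists2 C, 0 <= C & forall s, 1 <= s -> A j s <= C * s.
  elim: j => [|j [C C0 AC]].
    (* [F_H] at 0 gives [m s 1 <= s + (lambda + 1) / (6 s^2)], and [s >= 1]. *)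
    exists (1 + (lambda + 1) / 6).
      by rewrite addr_ge0// divr_ge0// ltW.
    move=> s s1; have s0 : 0 <= s by rewrite (le_trans ler01).
    have -> : A 0 s = m s 1.
      by rewrite /A expr0 -['X * 1]mulr1 -mulrA functionalXM mulr1 functional1.
    have := F_H 0 s; rewrite H_0 mul0r subr0 F_0 => E0.
    have F1 := F_ge0 1 s0.
    have s2 : 0 < 6 * s ^+ 2 by rewrite mulr_gt0// exprn_gt0// (lt_le_trans ltr01).
    have s3 : 0 <= (lambda + 1) * (s ^+ 3 - 1).
      by rewrite mulr_ge0 ?subr_ge0 ?exprn_ege1// ltW.
    rewrite -(ler_pM2l s2) -subr_ge0.
    rewrite (_ : _ - _ = (lambda + 1) * (s ^+ 3 - 1) + 3 * F 1 s).
      by rewrite addr_ge0// mulr_ge0.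
    by apply: (eq_by_combination (k := - 1) E0); field.
  exists ((lambda + 2 + 3 * j%:R) * C).
    by rewrite mulr_ge0// addr_ge0// ?mulr_ge0//; lra.
  move=> s s1; have s0 : 0 <= s by rewrite (le_trans ler01).
  have := A_step j s0; have := A_ge0 j.+1 s0; have := AC s s1.
  have : 0 <= (lambda + 1) * (s * F j s) by rewrite !mulr_ge0// ?F_ge0// ltW.
  have : 0 <= lambda + 2 + 3 * j%:R.
    by rewrite addr_ge0// ?mulr_ge0//; lra.
  set c := lambda + 2 + _; set u := A j s; nra.
have [C C0 AC] := Ab.
exists ((lambda + 2 + 3 * j%:R) * C / (lambda + 1)) => s s1.
have s0 : 0 < s by rewrite (lt_le_trans ltr01).
rewrite ler_pdivlMr// -(ler_pM2r s0).
have := A_step j (ltW s0); have := A_ge0 j.+1 (ltW s0); have := AC s s1.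
have : 0 <= lambda + 2 + 3 * j%:R.
  by rewrite addr_ge0// ?mulr_ge0//; lra.
set c := lambda + 2 + _; set u := A j s; nra.
Qed.

(** The Euler derivative of each [F j] is a polynomial in gap moments, so bounds on all of them
    suffice; the induction on [N] keeps [j] general. *)
Lemma gap_moment_symbol N j : symbol N (F j).
Proof.
have Fb i : exists C, \forall s \near +oo, `|F i s| <= C.
  have [C FC] := gap_moment_bounded i; exists C; near=> s.
  have s1 : 1 <= s by near: s; apply: nbhs_pinfty_ge; exact: num_real.
  by rewrite ger0_norm ?FC// F_ge0// (le_trans ler01).
elim: N j => [|N IH] j; split=> //.
exists (fun s => 3 * (j%:R * F j s - F j.+1 s + F 1 s * F j s)); split.
  near=> s; apply: is_derive_gap_moment.
  by near: s; exact: near_pinfty_neq0.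
have sj := IH j; have sj1 := IH j.+1; have s1 := IH 1%N; prove_symbol.
Unshelve. all: by end_near. Qed.

Lemma mean_gap_moment (s : R) : s != 0 ->
  m s 1 / s = 1 + cube_inv s * ((lambda + 1 - 3 * F 1 s) / 6).
Proof.
move=> s0; have := F_H 0 s; rewrite H_0 mul0r subr0 F_0 => E0.
have -> : F 1 s = (lambda + 1 - 6 * s ^+ 2 * (m s 1 - s)) / 3.
  by apply: (eq_by_combination (k := 3^-1) E0); field.
by rewrite /cube_inv; field.
Qed.

End PositiveSide.

(** * Expansions as t tends to +oo *)

Section PositiveSideExpansion.
Context {R : realType} (lambda : R).
Local Notation x := (@cube_inv R).

Section Mean.
Variables (m : R -> nat -> R) (K : R -> R).
Hypothesis m_0 : forall s, m s 0 = 1.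
Hypothesis m_rec : forall s k,
  (lambda + 1 + k%:R) * m s k + 3 * s ^+ 2 * m s k.+1 = 3 * m s k.+3.
Hypothesis m_derive : forall s k,
  is_derive (s : R) 1 (m ^~ k) (6 * s * (m s k.+1 - m s 1 * m s k)).
Hypothesis K_symbol : forall N, symbol N K.
Hypothesis m_K : forall s, s != 0 -> m s 1 / s = 1 + x s * K s.

(** The derivative formula expresses the second and third moments by [K] and its Euler derivatives
    [K1], [K2]. The recurrence at [k = 0] then reads [K = p + x K'], and inserting this form into
    [K'] gives the next coefficient. *)
Lemma mean_expansion_pos N : exists H, symbol N H /\ \forall s \near +oo,
  m s 1 / s = 1 + (2 * lambda - 1) / 12 * x s
    - (12 * lambda ^+ 2 - 24 * lambda + 5) / 288 * x s ^+ 2 + x s ^+ 3 * H s.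
Proof.
have [K1 [KK1 sK1]] := symbol_euler (K_symbol N.+3).
have [K2 [KK2 sK2]] := symbol_euler sK1.
(* The derivative of [m s 1 = s * (1 + x s * K s)], hence [6 s] times the variance. *)
pose D1 s := 1 + x s * (K1 s - 2 * K s).
have m1E : \forall s \near +oo, m s 1 = s * (1 + x s * K s).
  near=> s; have s0 : s != 0 by near: s; exact: near_pinfty_neq0.
  by rewrite -m_K// mulrC divfK.
have m2E : \forall s \near +oo, m s 2 = m s 1 ^+ 2 + D1 s / (6 * s).
  near=> s; have s0 : s != 0 by near: s; exact: near_pinfty_neq0.
  have dK : is_derive s 1 K (K1 s / s) by near: s.
  have dm : is_derive s 1 (m ^~ 1%N) (1 * (1 + x s * K s)
      + s * (0 + ((- 3 * x s / s) * K s + x s * (K1 s / s)))).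
    apply: (@near_eq_is_derive1 _ (fun s => s * (1 + x s * K s))).
      by near: s; apply: near_pinfty_nbhs; near=> s; apply/esym; near: s.
    exact: is_derive1M (is_derive1_id s)
      (is_derive1D (is_derive1_cst 1 s) (is_derive1M (is_derive_cube_inv s0) dK)).
  have E := is_derive1_unique (m_derive s 1) dm.
  apply: (eq_by_combination (k := (6 * s)^-1) E).
  by rewrite /D1; field.
have m3E : \forall s \near +oo, m s 3 = m s 1 * m s 2
    + (2 * m s 1 * D1 s
       + (x s * (K2 s - 5 * K1 s + 6 * K s) - D1 s) / (6 * s ^+ 2)) / (6 * s).
  near=> s; have s0 : s != 0 by near: s; exact: near_pinfty_neq0.
  have s60 : 6 * s != 0 by rewrite mulf_neq0.
  have dK : is_derive s 1 K (K1 s / s) by near: s.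
  have dK1 : is_derive s 1 K1 (K2 s / s) by near: s.
  have dx := is_derive_cube_inv s0.
  have dD : is_derive s 1 D1 (0 + ((- 3 * x s / s) * (K1 s - 2 * K s)
      + x s * (K2 s / s - (0 * K s + 2 * (K1 s / s))))).
    exact: is_derive1D (is_derive1_cst 1 s) (is_derive1M dx
      (is_derive1B dK1 (is_derive1M (is_derive1_cst 2 s) dK))).
  have d6 := is_derive1M (is_derive1_cst 6 s) (is_derive1_id s).
  have dm := is_derive1D (is_derive1X 2 (m_derive s 1)) (is_derive1_div s60 dD d6).
  have {}dm := @near_eq_is_derive1 _ _ (m ^~ 2%N) _ _ _ dm.
  have E := is_derive1_unique (m_derive s 2) (dm _).
  have m2s : m s 2 = m s 1 ^+ 2 + D1 s / (6 * s) by near: s.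
  apply: (eq_by_combination (k := (6 * s)^-1) (E _)).
    by near: s; apply: near_pinfty_nbhs; near=> s; apply/esym; near: s.
  by rewrite m2s /D1 /=; field.
pose p := (2 * lambda - 1) / 12.
(* Obtained by solving the recurrence at [k = 0] for [K s - p] and dividing by [x s]. *)
pose K' s := - 2^-1 * (3 * K s ^+ 2 + 2^-1 * (K1 s - K s) - 36^-1
  + x s * (K s ^+ 3 + 2^-1 * (K s * (K1 s - 2 * K s))
           + 36^-1 * (K2 s - 6 * K1 s + 8 * K s))).
have sK : symbol N.+1 K by [].
have {}sK1 := symbolW sK1.
have sK' : symbol N.+1 K' by rewrite /K'; prove_symbol.
have KE : \forall s \near +oo, K s = p + x s * K' s.
  near=> s; have s0 : s != 0 by near: s; exact: near_pinfty_neq0.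
  have E : 3 * m s 3 = lambda + 1 + 3 * s ^+ 2 * m s 1.
    by have := m_rec s 0; rewrite m_0 mulr1 addr0.
  have m1s : m s 1 = s * (1 + x s * K s) by near: s.
  have m2s : m s 2 = m s 1 ^+ 2 + D1 s / (6 * s) by near: s.
  have m3s : m s 3 = m s 1 * m s 2 + (2 * m s 1 * D1 s
       + (x s * (K2 s - 5 * K1 s + 6 * K s) - D1 s) / (6 * s ^+ 2)) / (6 * s).
    by near: s.
  move: E; rewrite m3s m2s m1s => E.
  apply: (eq_by_combination (k := 6^-1) E).
  by rewrite /K' /D1 /p /cube_inv; field.
have [K'1 [KK'1 sK'1]] := symbol_euler sK'.
have {}sK' := symbolW sK'; have {}sK := symbolW sK; have {}sK1 := symbolW sK1.
have {}sK2 := symbolW sK2.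
exists (fun s => - 2^-1 * (6 * p * K' s + 3 * (x s * K' s ^+ 2)
  + 2^-1 * (K'1 s - 4 * K' s) + (K s ^+ 3 + 2^-1 * (K s * (K1 s - 2 * K s))
    + 36^-1 * (K2 s - 6 * K1 s + 8 * K s)))); split; first by prove_symbol.
near=> s; have s0 : s != 0 by near: s; exact: near_pinfty_neq0.
have dK : is_derive s 1 K (K1 s / s) by near: s.
have dK' : is_derive s 1 K' (K'1 s / s) by near: s.
(* Differentiating the form [p + x K'] shows that [K1] is itself of order [x], so it does not affect
   the leading term of [K']. *)
have dK2 : is_derive s 1 K (0 + ((- 3 * x s / s) * K' s + x s * (K'1 s / s))).
  apply: (@near_eq_is_derive1 _ (fun s => p + x s * K' s)).
    by near: s; apply: near_pinfty_nbhs; near=> s; apply/esym; near: s.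
  exact: is_derive1D (is_derive1_cst p s) (is_derive1M (is_derive_cube_inv s0) dK').
have K1E : K1 s = x s * (K'1 s - 3 * K' s).
  apply: (eq_by_combination (k := s) (is_derive1_unique dK dK2)); by field.
have Ks : K s = p + x s * K' s by near: s.
have K'E : K' s = - 2^-1 * (3 * K s ^+ 2 + 2^-1 * (K1 s - K s) - 36^-1
  + x s * (K s ^+ 3 + 2^-1 * (K s * (K1 s - 2 * K s))
           + 36^-1 * (K2 s - 6 * K1 s + 8 * K s))) by [].
rewrite m_K//; move: K'E; set T := K s ^+ 3 + _ + _; rewrite K1E Ks => K'E.
by apply: (eq_by_combination (k := x s ^+ 2) K'E); rewrite /p; field.
Unshelve. all: by end_near. Qed.

End Mean.

Section Recurrence.
Variable b : R -> nat -> R.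
Hypothesis b_0 : forall s, b s 0 = 0.
Hypothesis b_gt0 : forall s n, 0 < b s n.+1.
Hypothesis b_derive : forall s n, is_derive (s : R) 1 (b ^~ n.+1)
  (6 * s * (b s n.+1 * (b s n.+2 - b s n))).
Hypothesis b_1 : forall N, exists H, symbol N H /\ \forall s \near +oo,
  b s 1 / s = 1 + (2 * lambda - 1) / 12 * x s
    - (12 * lambda ^+ 2 - 24 * lambda + 5) / 288 * x s ^+ 2 + x s ^+ 3 * H s.

(* In terms of [t = 3 s^2] these are expansions in powers of [t^(-3/2)]. *)
Definition even_expansion n : Prop := forall N,
  exists G, symbol N G /\ \forall s \near +oo,
  s ^+ 2 * b s (2 * n)%N = n%:R / 6
    + n%:R * (2 * n%:R - 2 * lambda - 1) / 24 * x s + x s ^+ 2 * G s.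

Definition odd_expansion n : Prop := forall N,
  exists H, symbol N H /\ \forall s \near +oo,
  b s (2 * n).+1 / s = 1 - (4 * n%:R - 2 * lambda + 1) / 12 * x s
    - (36 * n%:R ^+ 2 - 72 * lambda * n%:R + 12 * lambda ^+ 2 - 24 * lambda + 5)
      / 288 * x s ^+ 2 + x s ^+ 3 * H s.

(** By the Volterra equation the Euler logarithmic derivative of [b_(2n+1) / s] is
    [6 (s^2 b_(2n+2) - s^2 b_(2n)) - 1]; the [- 1] raises the leading coefficient from [n / 6] to
    [(n + 1) / 6]. *)
Let even_step n : even_expansion n -> odd_expansion n -> even_expansion n.+1.
Proof.
move=> en on N; have [G [sG bG]] := en N; have [H [sH bH]] := on N.+1.
pose u := - ((4 * n%:R - 2 * lambda + 1) / 12) : R.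
pose v := - ((36 * n%:R ^+ 2 - 72 * lambda * n%:R + 12 * lambda ^+ 2
  - 24 * lambda + 5) / 288) : R.
have [||||K [sK hK]] := @expansion_log_derivative _ N 1 u
    (fun s => b s (2 * n).+1 / s)
    (fun s => b s (2 * n).+1 / s * (6 * (s ^+ 2 * b s (2 * n).+2
       - s ^+ 2 * b s (2 * n)%N) - 1)) (fun s => v + x s * H s).
- exact: oner_neq0.
- by prove_symbol.
- near=> s; rewrite (_ : b s _ / s = 1 - (4 * n%:R - 2 * lambda + 1) / 12 * x s
    - (36 * n%:R ^+ 2 - 72 * lambda * n%:R + 12 * lambda ^+ 2 - 24 * lambda + 5)
      / 288 * x s ^+ 2 + x s ^+ 3 * H s); last by near: s.
  by rewrite /u /v; ring.
- near=> s; have s0 : s != 0 by near: s; exact: near_pinfty_neq0.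
  apply: (is_derive_eq (is_derive1_div s0 (b_derive s (2 * n)) (is_derive1_id s))).
  by field.
exists (fun s => G s + 6^-1 * K s); split; first by prove_symbol.
near=> s; have s0 : s != 0 by near: s; exact: near_pinfty_neq0.
have b0 : b s (2 * n).+1 != 0 by rewrite gt_eqF.
have bGs : s ^+ 2 * b s (2 * n)%N = n%:R / 6
    + n%:R * (2 * n%:R - 2 * lambda - 1) / 24 * x s + x s ^+ 2 * G s by near: s.
have : b s (2 * n).+1 / s * (6 * (s ^+ 2 * b s (2 * n).+2
     - s ^+ 2 * b s (2 * n)%N) - 1) / (b s (2 * n).+1 / s)
    = - 3 * (u / 1) * x s + x s ^+ 2 * K s by near: s.
rewrite mulrAC divff ?mul1r ?mulf_neq0 ?invr_eq0// bGs divr1 => E.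
rewrite mulnS add2n; apply: (eq_by_combination (k := 6^-1) E).
by rewrite /u -!natr1; field.
Unshelve. all: by end_near. Qed.

(** The Euler logarithmic derivative of [s^2 b_(2n+2)] is [2 + 6 s^3 (b_(2n+3) / s - b_(2n+1) / s)].
    Division by [6 s^3] supplies the extra factor [x] in the remainder. *)
Let odd_step n : even_expansion n.+1 -> odd_expansion n -> odd_expansion n.+1.
Proof.
move=> en on N; have [G [sG]] := en N.+1; have [H [sH bH]] := on N.
rewrite mulnS add2n => bG.
pose c := n.+1%:R / 6 : R.
pose d := n.+1%:R * (2 * n.+1%:R - 2 * lambda - 1) / 24 : R.
have [||||K [sK hK]] := @expansion_log_derivative _ N c d
    (fun s => s ^+ 2 * b s (2 * n).+2)
    (fun s => s ^+ 2 * b s (2 * n).+2 * (2 + 6 * s ^+ 3 * (b s (2 * n).+3 / s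
       - b s (2 * n).+1 / s))) G.
- by rewrite /c mulf_neq0// pnatr_eq0.
- exact: sG.
- exact: bG.
- near=> s; have s0 : s != 0 by near: s; exact: near_pinfty_neq0.
  apply: (is_derive_eq (is_derive1M (is_derive1X 2 (is_derive1_id s))
    (b_derive s (2 * n).+1))).
  by rewrite /=; field.
exists (fun s => H s + 6^-1 * K s); split; first by prove_symbol.
near=> s; have s0 : s != 0 by near: s; exact: near_pinfty_neq0.
have b0 : b s (2 * n).+2 != 0 by rewrite gt_eqF.
have bHs : b s (2 * n).+1 / s = 1 - (4 * n%:R - 2 * lambda + 1) / 12 * x s
    - (36 * n%:R ^+ 2 - 72 * lambda * n%:R + 12 * lambda ^+ 2 - 24 * lambda + 5)
      / 288 * x s ^+ 2 + x s ^+ 3 * H s by near: s.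
have : s ^+ 2 * b s (2 * n).+2 * (2 + 6 * s ^+ 3 * (b s (2 * n).+3 / s
     - b s (2 * n).+1 / s)) / (s ^+ 2 * b s (2 * n).+2)
    = - 3 * (d / c) * x s + x s ^+ 2 * K s by near: s.
rewrite mulrAC divff ?mul1r ?mulf_neq0 ?expf_neq0// bHs => E.
have dc : d / c = (2 * n.+1%:R - 2 * lambda - 1) / 4.
  by rewrite /d /c; field; rewrite nat1r pnatr_eq0.
rewrite dc in E.
apply: (eq_by_combination (k := x s / 6) E).
have xs : s ^+ 3 * x s = 1 by rewrite /cube_inv; field.
apply: (eq_by_combination (k := - (b s (2 * n).+3 / s) + b s (2 * n).+1 / s) xs).
rewrite bHs -!natr1; field.
Unshelve. all: by end_near. Qed.

Lemma expansions_pos n : even_expansion n /\ odd_expansion n.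
Proof.
elim: n => [|n [en on]].
  split=> N.
    exists (fun _ => 0); split; first exact: symbol_cst.
    by near=> s; rewrite b_0; ring.
  have [H [sH bH]] := b_1 N; exists H; split=> //.
  near=> s; rewrite (_ : b s _ / s = 1 + (2 * lambda - 1) / 12 * x s
    - (12 * lambda ^+ 2 - 24 * lambda + 5) / 288 * x s ^+ 2 + x s ^+ 3 * H s).
    by ring.
  by near: s.
have en1 := even_step en on.
by split=> //; exact: odd_step.
Unshelve. all: by end_near. Qed.

End Recurrence.
End PositiveSideExpansion.

(** * Expansions as t tends to -oo *)

Section NegativeSideExpansion.
Context {R : realType} (lambda : R).
Local Notation x := (@cube_inv R).

Section Mean.
Variable m : R -> nat -> R.
Hypothesis lambda_gt : -1 < lambda.
Hypothesis m_0 : forall s, m s 0 = 1.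
Hypothesis m_ge0 : forall s k, 0 <= m s k.
Hypothesis m_rec : forall s k,
  (lambda + 1 + k%:R) * m s k - s * m s k.+1 = 3 * m s k.+3.
Hypothesis m_derive : forall s k,
  is_derive (s : R) 1 (m ^~ k) (- (m s k.+1 - m s 1 * m s k)).

Let F k s := s ^+ k * m s k.

Let F_ge0 k s : 0 <= s -> 0 <= F k s.
Proof. by move=> s0; rewrite mulr_ge0// exprn_ge0. Qed.

(** To leading order these are the moments of a Gamma law; the sextic term enters only with the
    small factor [x s]. *)
Let F_rec k s : s != 0 ->
  F k.+1 s = (lambda + 1 + k%:R) * F k s - 3 * (x s * F k.+3 s).
Proof.
move=> s0; apply: (eq_by_combination (k := - s ^+ k) (m_rec s k)).
by rewrite /F /cube_inv !exprS; field.
Qed.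

(** The sextic term has a favourable sign, so [F k.+1 <= (lambda + 1 + k) F k] with a nonnegative
    factor. *)
Let F_bounded k : exists C, forall s, 0 < s -> F k s <= C.
Proof.
elim: k => [|k [C FC]].
  by exists 1 => s s0; rewrite /F m_0 expr0 mulr1.
exists ((lambda + 1 + k%:R) * C) => s s0; rewrite F_rec ?gt_eqF//.
have l1 : 0 <= lambda + 1 + k%:R by rewrite addr_ge0// -lerBlDr sub0r ltW.
rewrite (le_trans _ (ler_wpM2l l1 (FC s s0)))// gerBl.
have x0 : 0 <= x s by rewrite exprn_ge0// invr_ge0 ltW.
exact: mulr_ge0 (ler0n _ 3) (mulr_ge0 x0 (F_ge0 _ (ltW s0))).
Qed.

Let near_gt0 : \forall s \near +oo, 0 < s :> R.
Proof. by apply: nbhs_pinfty_gt; exact: num_real. Qed.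

Let F_symbol N k : symbol N (F k).
Proof.
have Fb i : exists C, \forall s \near +oo, `|F i s| <= C.
  have [C FC] := F_bounded i; exists C; near=> s.
  have s0 : 0 < s by near: s.
  by rewrite ger0_norm ?FC// F_ge0// ltW.
elim: N k => [|N IH] k; split=> //.
exists (fun s => k%:R * F k s - F k.+1 s + F 1 s * F k s); split.
  near=> s; have s0 : s != 0 by near: s; exact: near_pinfty_neq0.
  apply: (is_derive_eq (is_derive1M (is_derive1X k (is_derive1_id s)) (m_derive s k))).
  rewrite /F; case: k => [|k]; first by rewrite !expr0 !expr1 m_0; field.
  by rewrite !exprS expr0 /=; field.
have sk := IH k; have sk1 := IH k.+1; have s1 := IH 1%N; prove_symbol.
Unshelve. all: by end_near. Qed.

Lemma mean_expansion_neg N : exists G, symbol N G /\ \forall s \near +oo,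
  s * m s 1 = lambda + 1 - 3 * (lambda + 1) * (lambda + 2) * (lambda + 3) * x s
    + x s ^+ 2 * G s.
Proof.
exists (fun s => 9 * F 5 s + 9 * (lambda + 3) * F 4 s
   + 9 * (lambda + 3) * (lambda + 2) * F 3 s); split.
  have s5 := F_symbol N 5; have s4 := F_symbol N 4; have s3 := F_symbol N 3.
  by prove_symbol.
near=> s; have s0 : s != 0 by near: s; exact: near_pinfty_neq0.
have F0 : F 0 s = 1 by rewrite /F expr0 m_0 mulr1.
have F1 := F_rec 0 s0; have F2 := F_rec 1 s0; have F3 := F_rec 2 s0.
have -> : s * m s 1 = F 1 s by rewrite /F expr1.
(* Only the [F 3 s] on the left is unrolled down to [F 0 s]; the copies in the remainder stay. *)
rewrite F1 F0; set y := F 3 s; rewrite [in LHS]/y F3 F2 {1}F1 F0 -/y.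
ring.
Unshelve. all: by end_near. Qed.

End Mean.

Section Recurrence.
Variable b : R -> nat -> R.
Hypothesis b_0 : forall s, b s 0 = 0.
Hypothesis b_gt0 : forall s n, 0 < b s n.+1.
Hypothesis b_derive : forall s n, is_derive (s : R) 1 (b ^~ n.+1)
  (- (b s n.+1 * (b s n.+2 - b s n))).
Hypothesis lambda_gt : -1 < lambda.
Hypothesis b_1 : forall N, exists G, symbol N G /\ \forall s \near +oo,
  s * b s 1 = lambda + 1 - 3 * (lambda + 1) * (lambda + 2) * (lambda + 3) * x s
    + x s ^+ 2 * G s.

Definition expansion k (c d : R) : Prop := forall N, exists G, symbol N G /\
  \forall s \near +oo, s * b s k = c + d * x s + x s ^+ 2 * G s.

(** For [t = - s] the Euler logarithmic derivative of [s b_(k+1)] is [1 - (s b_(k+2) - s b_k)];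
    solving for [s b_(k+2)] yields the new coefficients. *)
Let expansion_step k c d c' d' : expansion k c d -> expansion k.+1 c' d' ->
  c' != 0 -> expansion k.+2 (c + 1) (d + 3 * (d' / c')).
Proof.
move=> ek ek1 c0 N; have [G [sG bG]] := ek N; have [H [sH bH]] := ek1 N.+1.
have [|K [sK hK]] := expansion_log_derivative
    (h := fun s => s * b s k.+1 * (1 - (s * b s k.+2 - s * b s k))) c0 sH bH.
  near=> s; have s0 : s != 0 by near: s; exact: near_pinfty_neq0.
  apply: (is_derive_eq (is_derive1M (is_derive1_id s) (b_derive s k))).
  by field.
exists (fun s => G s - K s); split; first by prove_symbol.
near=> s; have s0 : s != 0 by near: s; exact: near_pinfty_neq0.
have b0 : b s k.+1 != 0 by rewrite gt_eqF.
have bGs : s * b s k = c + d * x s + x s ^+ 2 * G s by near: s.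
have : s * b s k.+1 * (1 - (s * b s k.+2 - s * b s k)) / (s * b s k.+1)
    = - 3 * (d' / c') * x s + x s ^+ 2 * K s by near: s.
rewrite mulrAC divff ?mul1r ?mulf_neq0// bGs => E.
by apply: (eq_by_combination (k := - 1) E); field.
Unshelve. all: by end_near. Qed.

(** As [t = - s], a coefficient of [s^-3] in [s b] is, sign included, the coefficient of [t^-4] in
    [beta]. *)
Definition even_coef n : R :=
  - (3 * n%:R * (10 * n%:R ^+ 2 + 6 * (2 * lambda + 1) * n%:R
  + 3 * lambda ^+ 2 + 3 * lambda + 2)).
Definition odd_coef n : R :=
  - (3 * (n%:R + lambda + 1) * (10 * n%:R ^+ 2
  + (8 * lambda + 14) * n%:R + (lambda + 3) * (lambda + 2))).

(** The closed forms satisfy the recursion of [expansion_step]; its denominators [n + lambda + 1]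
    and [n + 1] divide [odd_coef n] and [even_coef n.+1]. *)
Lemma expansions_neg n : expansion (2 * n) n%:R (even_coef n) /\
  expansion (2 * n).+1 (n%:R + lambda + 1) (odd_coef n).
Proof.
have l1 k : k%:R + lambda + 1 != 0 :> R.
  rewrite gt_eqF// -addrA ltr_wpDl//.
  by rewrite -ltrBlDr sub0r.
elim: n => [|n [en on]].
  split=> N.
    exists (fun _ => 0); split; first exact: symbol_cst.
    by near=> s; rewrite b_0 /even_coef; ring.
  have [G [sG bG]] := b_1 N; exists G; split=> //.
  near=> s; rewrite (_ : s * b s _ = lambda + 1
     - 3 * (lambda + 1) * (lambda + 2) * (lambda + 3) * x s + x s ^+ 2 * G s).
    by rewrite /odd_coef; ring.
  by near: s.
rewrite mulnS add2n.
have en1 : expansion (2 * n).+2 n.+1%:R (even_coef n.+1).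
  have := expansion_step en on (l1 n).
  rewrite natr1 (_ : _ + _ = even_coef n.+1)//.
  rewrite /even_coef /odd_coef -!natr1; field; exact: l1.
split=> //.
have := expansion_step on en1; rewrite pnatr_eq0 => /(_ isT).
rewrite (_ : n%:R + lambda + 1 + 1 = n.+1%:R + lambda + 1); last by rewrite -natr1; ring.
rewrite (_ : _ + 3 * _ = odd_coef n.+1)//.
rewrite /even_coef /odd_coef -!natr1; field.
by rewrite natr1 pnatr_eq0.
Unshelve. all: by end_near. Qed.

End Recurrence.
End NegativeSideExpansion.

(** * Application to the sextic Freud weight and return to the variable t *)

Lemma eqaddO_ex {R : realType} (F : filter_on R) (f g e : R -> R) (C : R) :
  (\forall t \near F, `|f t - g t| <= C * `|e t|) -> f = g +O_F e.
Proof.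
(* The big-O criterion asks for a positive constant, while [C] is arbitrary. *)
move=> fgC; apply/eqaddOP/bigO_exP; exists (`|C| + 1).
  by rewrite ltr_pwDr.
near=> t; have : `|f t - g t| <= C * `|e t| by near: t.
move=> /le_trans; apply; rewrite ler_wpM2r//.
by apply: (le_trans (ler_norm _)); rewrite lerDl.
Unshelve. all: by end_near. Qed.

Section FreudAsymptotics.
Context {R : realType} (lambda : R).
Hypothesis lambda_gt : -1 < lambda.
Variables (P : R -> nat -> {poly R}) (beta : R -> nat -> R).
Hypothesis P_orth :
  forall t : R, monic_orthogonal (freud_weight lambda t) (P t).
Hypothesis beta_rec : forall t : R, recurrence_coefficients (P t) (beta t).
Local Notation mu := (@lebesgue_measure R).
Local Notation w := (freud_weight lambda).
Local Notation x := (@cube_inv R).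

Let P_monic t n : P t n \is monic.
Proof. by have [/(_ n)[]] := P_orth t. Qed.

Let P_size t n : size (P t n) = n.+1.
Proof. by have [/(_ n)[]] := P_orth t. Qed.

Let mass_gt0 t : 0 < \int[mu]_x w t x.
Proof.
have [_ _ /(_ 0%N)] := P_orth t; rewrite /weighted_dot (P_0 P_monic P_size).
by under eq_Rintegral do rewrite hornerC !mul1r.
Qed.

(** The exponent map [e] is the identity for polynomials in [x] and doubling for polynomials in
    [y = x^2]. *)
Lemma functional_momentE t (e : nat -> nat) (p : {poly R}) :
  functional (fun k => moment lambda t (e k)) p
    = \int[mu]_x ((\sum_(i < size p) p`_i * x ^+ e i) * w t x).
Proof.
have iZ c k : mu.-integrable setT (EFin \o (fun x => c * (x ^+ k * w t x))).
  rewrite /comp; under eq_fun do rewrite EFinM.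
  by apply: integrableZl => //; exact: integrable_monomial.
rewrite /functional; elim: (size p) => [|N IH].
  rewrite big_ord0; under eq_Rintegral do rewrite big_ord0 mul0r.
  by rewrite /Rintegral integral0.
rewrite big_ord_recr /= IH.
under [RHS]eq_Rintegral do rewrite big_ord_recr /= mulrDl -mulrA.
rewrite RintegralD//=.
- by congr (_ + _); rewrite RintegralZl//; exact: integrable_monomial.
- rewrite [X in integrable _ _ X](_ : _ = fun y =>
    (\sum_(i < N) (p`_i * (y ^+ e i * w t y))%:E)%E).
    by apply: integrable_sum => // i _; exact: iZ.
  apply/funext => y /=; rewrite mulr_suml sumEFin; congr EFin.
  by apply: eq_bigr => i _; rewrite -mulrA.
Qed.

Let dot_functional t p q :
  weighted_dot (w t) p q = functional (moment lambda t) (p * q).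
Proof.
rewrite (functional_momentE t id); apply: eq_Rintegral => y _.
by rewrite -hornerM horner_coef.
Qed.

Let orthE t i j : i != j ->
  functional (moment lambda t) (P t i * P t j) = 0.
Proof. by move=> ij; rewrite -dot_functional; have [_ ->] := P_orth t. Qed.

Let posE t n : 0 < functional (moment lambda t) (P t n * P t n).
Proof. by rewrite -dot_functional; have [_ _] := P_orth t. Qed.

Let beta_derive (t : R) n : is_derive t 1 (beta ^~ n.+1)
  (beta t n.+1 * (beta t n.+2 - beta t n)).
Proof.
exact: is_derive_beta (is_derive_moment mass_gt0) P_monic P_size orthE posE
  beta_rec t n.
Qed.

Let beta_pos t n : 0 < beta t n.+1.
Proof. exact: beta_gt0 orthE posE beta_rec t n. Qed.

Let beta_0 t : beta t 0 = 0. Proof. by have [] := beta_rec t. Qed.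

Let moment0_gt0 t : 0 < moment lambda t 0.
Proof.
rewrite /moment; under eq_Rintegral do rewrite expr0 mul1r.
exact: mass_gt0.
Qed.

Let nmoment t k := moment lambda t (2 * k) / moment lambda t 0.

Let nmoment_0 t : nmoment t 0 = 1.
Proof. by rewrite /nmoment muln0 divff// gt_eqF. Qed.

Let nmoment_1 t : nmoment t 1 = beta t 1.
Proof. by rewrite (beta_1E P_monic P_size orthE posE beta_rec). Qed.

(** The functional is the mean of [p (x^2)], so only values of [p] on the half-line matter. *)
Let nmoment_pos t (p : {poly R}) : (forall y, 0 <= y -> 0 <= p.[y]) ->
  0 <= functional (nmoment t) p.
Proof.
move=> p0; rewrite (_ : functional _ _ =
    functional (fun k => moment lambda t (2 * k)%N) p / moment lambda t 0).
  rewrite divr_ge0 ?(ltW (moment0_gt0 t))// functional_momentE.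
  apply: Rintegral_ge0 => y _; rewrite mulr_ge0 ?freud_weight_ge0//.
  under eq_bigr do rewrite exprM.
  by rewrite -horner_coef p0// sqr_ge0.
rewrite /functional mulr_suml; apply: eq_bigr => i _; exact: mulrA.
Qed.

Let nmoment_ge0 t k : 0 <= nmoment t k.
Proof.
have := @nmoment_pos t 'X^k; rewrite /functional size_polyXn.
under eq_bigr do rewrite coefXn.
rewrite big_ord_recr /= eqxx mul1r big1 ?add0r => [|i _].
  by apply => y y0; rewrite hornerXn exprn_ge0.
by rewrite ltn_eqF// mul0r.
Qed.

Let nmoment_rec t k :
  (lambda + 1 + k%:R) * nmoment t k + t * nmoment t k.+1 = 3 * nmoment t k.+3.
Proof.
have E := moment_recurrence mass_gt0 t (2 * k) lambda_gt.
rewrite /nmoment !mulnS !add2n.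
apply: (eq_by_combination (k := (2 * moment lambda t 0)^-1) E).
have m0 : moment lambda t 0 != 0 by rewrite gt_eqF.
by rewrite natrM; field.
Qed.

Let nmoment_derive (t : R) k : is_derive t 1 (nmoment ^~ k)
  (nmoment t k.+1 - nmoment t 1 * nmoment t k).
Proof.
have m0 : moment lambda t 0 != 0 by rewrite gt_eqF.
apply: (is_derive_eq (is_derive1_div m0 (is_derive_moment mass_gt0 t (2 * k))
  (is_derive_moment mass_gt0 t 0))).
by rewrite /nmoment mulnS add2n muln1; field.
Qed.

Let tau_derive (s : R) : is_derive s 1 (fun u => 3 * u ^+ 2) (6 * s).
Proof.
apply: (is_derive_eq (is_derive1M (is_derive1_cst 3 s)
  (is_derive1X 2 (is_derive1_id s)))).
by rewrite /=; ring.
Qed.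

Let beta_expansions_pos n :
  even_expansion lambda (fun s => beta (3 * s ^+ 2)) n /\
  odd_expansion lambda (fun s => beta (3 * s ^+ 2)) n.
Proof.
pose m s := nmoment (3 * s ^+ 2).
have m_derive s k : is_derive (s : R) 1 (m ^~ k)
    (6 * s * (m s k.+1 - m s 1 * m s k)).
  apply: (is_derive_eq (@is_derive1_comp _ (nmoment ^~ k) (fun u => 3 * u ^+ 2)
    _ _ _ (nmoment_derive (3 * s ^+ 2) k) (tau_derive s))).
  by rewrite mulrC.
have m_rec s k := nmoment_rec (3 * s ^+ 2) k.
have m_0 s := nmoment_0 (3 * s ^+ 2).
have m_pos s p := @nmoment_pos (3 * s ^+ 2) p.
pose K s := (lambda + 1 - 3 * gap_moment m 1 s) / 6.
have sK N : symbol N K.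
  have sg := @gap_moment_symbol _ _ lambda_gt m m_0 m_pos m_rec m_derive N 1.
  by rewrite /K; prove_symbol.
apply: expansions_pos => //.
- move=> s k.
  apply: (is_derive_eq (@is_derive1_comp _ (beta ^~ k.+1) (fun u => 3 * u ^+ 2)
    _ _ _ (beta_derive (3 * s ^+ 2) k) (tau_derive s))).
  by rewrite mulrC.
- move=> N; have [H [sH mH]] := @mean_expansion_pos _ lambda m K m_0 m_rec
    m_derive sK (@mean_gap_moment _ lambda m m_0 m_rec) N.
  exists H; split=> //; near=> s.
  by rewrite -nmoment_1 -/(m s 1%N); near: s.
Unshelve. all: by end_near. Qed.

Let beta_expansions_neg n :
  expansion (fun s => beta (- s)) (2 * n) n%:R (even_coef lambda n) /\
  expansion (fun s => beta (- s)) (2 * n).+1 (n%:R + lambda + 1) (odd_coef lambda n).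
Proof.
pose m s := nmoment (- s).
have dN (s : R) := is_derive1N (is_derive1_id s).
have m_derive s k : is_derive (s : R) 1 (m ^~ k)
    (- (m s k.+1 - m s 1 * m s k)).
  apply: (is_derive_eq (@is_derive1_comp _ (nmoment ^~ k) (fun u => - u)
    _ _ _ (nmoment_derive (- s) k) (dN s))).
  by rewrite mulrN1.
have m_rec s k : (lambda + 1 + k%:R) * m s k - s * m s k.+1 = 3 * m s k.+3.
  by rewrite -mulNr; exact: nmoment_rec.
have m_0 s := nmoment_0 (- s).
have m_ge0 s k := nmoment_ge0 (- s) k.
apply: expansions_neg => //.
- move=> s k.
  apply: (is_derive_eq (@is_derive1_comp _ (beta ^~ k.+1) (fun u => - u)
    _ _ _ (beta_derive (- s) k) (dN s))).
  by rewrite mulrN1.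
- move=> N; have [G [sG mG]] := @mean_expansion_neg _ lambda m lambda_gt m_0
    m_ge0 m_rec m_derive N.
  exists G; split=> //; near=> s.
  by rewrite -nmoment_1 -/(m s 1%N); near: s.
Unshelve. all: by end_near. Qed.

Let near_sqrt3 (Q : R -> Prop) : (\forall s \near +oo, Q s) ->
  \forall t \near +oo, exists2 s, 0 < s & t = 3 * s ^+ 2 /\ Q s.
Proof.
move=> [M [_ MQ]]; near=> t.
have t0 : 0 < t by near: t; apply: nbhs_pinfty_gt; exact: num_real.
have tM : 3 * M ^+ 2 < t by near: t; apply: nbhs_pinfty_gt; exact: num_real.
exists (Num.sqrt (t / 3)); first by rewrite sqrtr_gt0 divr_gt0.
rewrite sqr_sqrtr; last by rewrite divr_ge0// ltW.
split; first by rewrite mulrC divfK.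
apply: MQ; apply: le_lt_trans (ler_norm M) _.
by rewrite -sqrtr_sqr ltr_sqrt ?divr_gt0// ltr_pdivlMr// mulrC.
Unshelve. all: by end_near. Qed.

Let near_opp (Q : R -> Prop) : (\forall s \near +oo, Q s) ->
  \forall t \near -oo, exists2 s, 0 < s & t = - s /\ Q s.
Proof.
move=> [M [Mr MQ]]; near=> t.
have t0 : t < 0 by near: t; apply: nbhs_ninfty_lt; exact: num_real.
have tM : t < - M by near: t; apply: nbhs_ninfty_lt; exact: num_real.
exists (- t); first by rewrite oppr_gt0.
by rewrite opprK; split=> //; apply: MQ; rewrite ltrNr.
Unshelve. all: by end_near. Qed.

Let powR52 (s : R) : 0 < s ->
  (3 * s ^+ 2) `^ (5 / 2) = 9 * Num.sqrt 3 * s ^+ 5.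
Proof.
move=> s0; have s2 : 0 <= 3 * s ^+ 2 by rewrite mulr_ge0// sqr_ge0.
rewrite powRrM powR12_sqrt ?powR_ge0// powR_mulrn//.
(* Both sides are nonnegative, so it suffices to compare squares. *)
apply/eqP; rewrite -(@eqrXn2 _ 2) ?sqrtr_ge0//; last first.
  exact: mulr_ge0 (mulr_ge0 (ler0n _ 9) (sqrtr_ge0 _)) (exprn_ge0 5 (ltW s0)).
rewrite sqr_sqrtr ?exprn_ge0// !exprMn sqr_sqrtr//.
by apply/eqP; ring.
Qed.

Let sqrt3t (s : R) : 0 < s -> Num.sqrt (3 * (3 * s ^+ 2)) = 3 * s.
Proof.
move=> s0; rewrite (_ : 3 * _ = (3 * s) ^+ 2); last by ring.
by rewrite sqrtr_sqr gtr0_norm// mulr_gt0.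
Qed.

Lemma even_asymptotics_pos n : (fun t : R => beta t (2 * n)%N)
  = (fun t : R => n%:R / (2 * t)
       + 3 * Num.sqrt 3 * n%:R * (2 * n%:R - 2 * lambda - 1) / (8 * t `^ (5 / 2)))
  +O_ (+oo_R) (fun t : R => t ^- 4).
Proof.
have [/(_ 0%N)[G [[[C GC] _] bG]] _] := beta_expansions_pos n.
(* For [t = 3 s^2] one has [t^-4 = s^-8 / 81], and dividing the remainder [x^2 G] by [s^2] leaves
   [s^-8 G]. *)
apply: (@eqaddO_ex _ _ _ _ _ (81 * C)); near=> t.
have [s s0 [-> [GCs bGs]]] : exists2 s, 0 < s & t = 3 * s ^+ 2 /\
   (`|G s| <= C /\ s ^+ 2 * beta (3 * s ^+ 2) (2 * n)%N = n%:R / 6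
    + n%:R * (2 * n%:R - 2 * lambda - 1) / 24 * x s + x s ^+ 2 * G s).
  by near: t; apply: near_sqrt3; near=> s; split; near: s.
rewrite powR52// (_ : beta _ _ - _ = s ^- 8 * G s).
  rewrite normrM !normfV !normrX (gtr0_norm s0) normrM normrX (gtr0_norm s0).
  rewrite (@ger0_norm _ 3)// (_ : 81 * C * _ = s ^- 8 * C).
    by rewrite ler_wpM2l// invr_ge0 exprn_ge0// ltW.
  by field; rewrite gt_eqF.
have r0 : Num.sqrt 3 != 0 :> R by rewrite sqrtr_eq0 -ltNge.
have s1 : s != 0 by rewrite gt_eqF.
apply: (eq_by_combination (k := s ^- 2) bGs).
by rewrite /cube_inv; field; rewrite s1 r0.
Unshelve. all: by end_near. Qed.

Lemma odd_asymptotics_pos n : (fun t : R => beta t (2 * n + 1)%N)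
  = (fun t : R => 1 / 3 * Num.sqrt (3 * t)
       - (4 * n%:R - 2 * lambda + 1) / (4 * t)
       - Num.sqrt 3
         * (36 * n%:R ^+ 2 - 72 * lambda * n%:R
            + 12 * lambda ^+ 2 - 24 * lambda + 5)
         / (32 * t `^ (5 / 2)))
  +O_ (+oo_R) (fun t : R => t ^- 4).
Proof.
have [_ /(_ 0%N)[G [[[C GC] _] bG]]] := beta_expansions_pos n.
(* Here the remainder [x^3 G] is multiplied by [s], which again leaves [s^-8 G]. *)
apply: (@eqaddO_ex _ _ _ _ _ (81 * C)); near=> t.
have [s s0 [-> [GCs bGs]]] : exists2 s, 0 < s & t = 3 * s ^+ 2 /\
   (`|G s| <= C /\ beta (3 * s ^+ 2) (2 * n).+1 / s
     = 1 - (4 * n%:R - 2 * lambda + 1) / 12 * x s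
    - (36 * n%:R ^+ 2 - 72 * lambda * n%:R + 12 * lambda ^+ 2 - 24 * lambda + 5)
      / 288 * x s ^+ 2 + x s ^+ 3 * G s).
  by near: t; apply: near_sqrt3; near=> s; split; near: s.
rewrite addn1 powR52// sqrt3t// (_ : beta _ _ - _ = s ^- 8 * G s).
  rewrite normrM !normfV !normrX (gtr0_norm s0) normrM normrX (gtr0_norm s0).
  rewrite (@ger0_norm _ 3)// (_ : 81 * C * _ = s ^- 8 * C).
    by rewrite ler_wpM2l// invr_ge0 exprn_ge0// ltW.
  by field; rewrite gt_eqF.
have r0 : Num.sqrt 3 != 0 :> R by rewrite sqrtr_eq0 -ltNge.
have s1 : s != 0 by rewrite gt_eqF.
apply: (eq_by_combination (k := s) bGs).
by rewrite /cube_inv; field; rewrite s1 r0.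
Unshelve. all: by end_near. Qed.

Let asymptotics_neg k (c d : R) : expansion (fun s => beta (- s)) k c d ->
  (fun t : R => beta t k) = (fun t : R => - (c / t) + d / t ^+ 4)
  +O_ (-oo_R) (fun t : R => t ^- 7).
Proof.
move=> /(_ 0%N)[G [[[C GC] _] bG]].
apply: (@eqaddO_ex _ _ _ _ _ C); near=> t.
have [s s0 [-> [GCs bGs]]] : exists2 s, 0 < s & t = - s /\
   (`|G s| <= C /\ s * beta (- s) k = c + d * x s + x s ^+ 2 * G s).
  by near: t; apply: near_opp; near=> s; split; near: s.
have s1 : s != 0 by rewrite gt_eqF.
rewrite (_ : beta _ _ - _ = s ^- 7 * G s).
  rewrite normrM !normfV !normrX normrN (gtr0_norm s0) mulrC.
  by rewrite ler_wpM2r// invr_ge0 exprn_ge0// ltW.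
apply: (eq_by_combination (k := s^-1) bGs).
by rewrite /cube_inv; field.
Unshelve. all: by end_near. Qed.

Lemma even_asymptotics_neg n : (fun t : R => beta t (2 * n)%N)
  = (fun t : R => - (n%:R / t)
       - 3 * n%:R
         * (10 * n%:R ^+ 2 + 6 * (2 * lambda + 1) * n%:R
            + 3 * lambda ^+ 2 + 3 * lambda + 2)
         / t ^+ 4)
  +O_ (-oo_R) (fun t : R => t ^- 7).
Proof.
have [/asymptotics_neg + _] := beta_expansions_neg n.
by rewrite /even_coef; under [in X in _ = X -> _]eq_fun do rewrite mulNr.
Qed.

Lemma odd_asymptotics_neg n : (fun t : R => beta t (2 * n + 1)%N)
  = (fun t : R => - ((n%:R + lambda + 1) / t)
       - 3 * (n%:R + lambda + 1)
         * (10 * n%:R ^+ 2 + (8 * lambda + 14) * n%:R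
            + (lambda + 3) * (lambda + 2))
         / t ^+ 4)
  +O_ (-oo_R) (fun t : R => t ^- 7).
Proof.
have [_ /asymptotics_neg] := beta_expansions_neg n.
by rewrite /odd_coef addn1; under [in X in _ = X -> _]eq_fun do rewrite mulNr.
Qed.

End FreudAsymptotics.

Unset Implicit Arguments.

Theorem lemma4p4 (R : realType) (lambda : R) (lambda_gt : -1 < lambda)
    (P : R -> nat -> {poly R}) (beta : R -> nat -> R)
    (P_orth : forall t : R, monic_orthogonal (freud_weight lambda t) (P t))
    (beta_rec : forall t : R, recurrence_coefficients (P t) (beta t))
    (n : nat) :
  [/\ (fun t : R => beta t (2 * n)%N)
      = (fun t : R =>
           n%:R / (2 * t)
           + 3 * Num.sqrt 3 * n%:R * (2 * n%:R - 2 * lambda - 1)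
             / (8 * t `^ (5 / 2)))
      +O_ (+oo_R) (fun t : R => t ^- 4),
      (fun t : R => beta t (2 * n + 1)%N)
      = (fun t : R =>
           1 / 3 * Num.sqrt (3 * t)
           - (4 * n%:R - 2 * lambda + 1) / (4 * t)
           - Num.sqrt 3
             * (36 * n%:R ^+ 2 - 72 * lambda * n%:R
                + 12 * lambda ^+ 2 - 24 * lambda + 5)
             / (32 * t `^ (5 / 2)))
      +O_ (+oo_R) (fun t : R => t ^- 4),
      (fun t : R => beta t (2 * n)%N)
      = (fun t : R =>
           - (n%:R / t)
           - 3 * n%:R
             * (10 * n%:R ^+ 2 + 6 * (2 * lambda + 1) * n%:R
                + 3 * lambda ^+ 2 + 3 * lambda + 2)
             / t ^+ 4)
      +O_ (-oo_R) (fun t : R => t ^- 7)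
    & (fun t : R => beta t (2 * n + 1)%N)
      = (fun t : R =>
           - ((n%:R + lambda + 1) / t)
           - 3 * (n%:R + lambda + 1)
             * (10 * n%:R ^+ 2 + (8 * lambda + 14) * n%:R
                + (lambda + 3) * (lambda + 2))
             / t ^+ 4)
      +O_ (-oo_R) (fun t : R => t ^- 7)].
Proof.
split.
- exact: even_asymptotics_pos.
- exact: odd_asymptotics_pos.
- exact: even_asymptotics_neg.
- exact: odd_asymptotics_neg.
Qed.
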